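(* Let $w\in\tilde S_n$ admit an affine factorization into two factors. Then the set of affine factorizations $uv$ of $w$ into two factors, with the operators $\tilde e_1,\tilde f_1$ and weight map described in the context, is a $U_q(\mathfrak{sl}_2)$-crystal (the crystal graph of an integrable $U_q(\mathfrak{sl}_2)$-module).
   Context: Fix $n\ge2$; letters are taken modulo $n$ in $[n]=\{0,\dots,n-1\}$. $\tilde S_n$ is the affine symmetric group generated by $s_0,\dots,s_{n-1}$ (relations $s_i^2=1$, $s_is_{i+1}s_i=s_{i+1}s_is_{i+1}$, $s_is_j=s_js_i$ for $|i-j|>1$). $\ell$ is length, $\mathrm{con}(w)$ the set of letters of a reduced word. An element is cyclically decreasing if it equals $s_{i_1}\cdots s_{i_p}$ for a word with no repeated letter in which for no $j$ does $j-1$ occur left of $j$; it is determined by its content (a proper subset of $[n]$) and each proper subset is a content. A two-factor affine factorization of $w$ of weight $(\beta_1,\beta_2)$ is $w=uv$ with $u,v$ cyclically decreasing, $\ell(v)=\beta_1$, $\ell(u)=\beta_2$, $\ell(w)=\beta_1+\beta_2$; its weight is $(\beta_1,\beta_2)$. Pairing. For $x\in[n]$ and letters $\neq x$, use the order $x-1>x-2>\cdots>0>n-1>\cdots>x+1$. Given contents $A\subseteq\mathrm{con}(u)$, $C\subseteq\mathrm{con}(v)$ avoiding $x$, the pairing with respect to $x$ processes $b\in A$ from largest to smallest, pairing $b$ with the smallest not-yet-paired $a\in C$ with $a>b$ (else $b$ unpaired); unchosen elements of $C$ are unpaired. If $w\in S_{\hat x}$ (subgroup generated by $s_i$, $i\ne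 x$) for some $x$, fix such $x$ and pair $A=\mathrm{con}(u)$ with $C=\mathrm{con}(v)$. Otherwise, there exist $b\in[n]$ and $t\ge1$ with $b-1,\dots,b-t\in\mathrm{con}(u)$, $b,\dots,b-t+1\in\mathrm{con}(v)$, $b\notin\mathrm{con}(u)$, $b-t\notin\mathrm{con}(v)$; fix such a $b$, declare $b-1\in\mathrm{con}(u)$ paired with $b\in\mathrm{con}(v)$, set $x=b$, and pair $A=\mathrm{con}(u)\setminus\{b-1\}$ with $C=\mathrm{con}(v)\setminus\{b\}$ with respect to $x$. Let $L_1$ (resp. $R_1$) be the unpaired elements of $\mathrm{con}(u)$ (resp. $\mathrm{con}(v)$); max/min refer to the order for $x$. Operators: if $L_1=\emptyset$, $\tilde e_1(uv)=\mathbf 0$; else with $b'=\min L_1$, $t'=\min\{i\ge0:b'-i-1\notin\mathrm{con}(u)\}$, $\tilde e_1(uv)=\tilde u\tilde v$ with $\mathrm{con}(\tilde u)=\mathrm{con}(u)\setminus\{b'\}$, $\mathrm{con}(\tilde v)=\mathrm{con}(v)\cup\{b'-t'\}$. If $R_1=\emptyset$, $\tilde f_1(uv)=\mathbf 0$; else with $a=\max R_1$, $s=\min\{i\ge0:a+i+1\notin\mathrm{con}(v)\}$, $\tilde f_1(uv)=\tilde u\tilde v$ with $\mathrm{con}(\tilde u)=\mathrm{con}(u)\cup\{a+s\}$, $\mathrm{con}(\tilde v)=\mathrm{con}(v)\setminus\{a\}$ (here $\tilde u,\tilde v$ are the cyclically decreasing elements with these contents). *)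

(* Defs.v *)
From HB Require Import structures.
From mathcomp Require Import all_boot all_order all_algebra all_fingroup.
From mathcomp Require Import boolp classical_sets.

Set Implicit Arguments.
Unset Strict Implicit.
Unset Printing Implicit Defensive.

Import GroupScope GRing.Theory Num.Theory.

Local Open Scope quotient_scope.

(* Letters are elements of ['I_n]; [ordS i] and [ord_pred i] are [i + 1] and
   [i - 1] modulo [n]. *)

Section AffineSymmetricGroup.
Variable n : nat.

(* For n = 2 there is no braid relation: [affS 2] is the infinite dihedral
   group. For n = 3 no two distinct letters commute. *)
Inductive affS_rel : seq 'I_n -> seq 'I_n -> Prop :=
| affS_involution i : affS_rel [:: i; i] [::]
| affS_braid i : (2 < n)%N ->
    affS_rel [:: i; ordS i; i] [:: ordS i; i; ordS i]
| affS_commute i j : j != i -> j != ordS i -> i != ordS j ->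
    affS_rel [:: i; j] [:: j; i].

Inductive affS_cong : seq 'I_n -> seq 'I_n -> Prop :=
| affS_cong_rel a r s b : affS_rel r s ->
    affS_cong (a ++ r ++ b) (a ++ s ++ b)
| affS_cong_refl a : affS_cong a a
| affS_cong_sym a b : affS_cong a b -> affS_cong b a
| affS_cong_trans a b c : affS_cong a b -> affS_cong b c -> affS_cong a c.

Definition affS_equiv : rel (seq 'I_n) := fun a b => `[< affS_cong a b >].

Fact affS_equiv_refl : reflexive affS_equiv.
Proof. by move=> a; apply/asboolP/affS_cong_refl. Qed.

Fact affS_equiv_sym : symmetric affS_equiv.
Proof.
by move=> a b; apply/asboolP/asboolP; apply: affS_cong_sym.
Qed.

Fact affS_equiv_trans : transitive affS_equiv.
Proof.
by move=> b a c /asboolP ab /asboolP bc; apply/asboolP/(affS_cong_trans ab bc).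
Qed.

Canonical affS_equiv_rel :=
  EquivRel affS_equiv affS_equiv_refl affS_equiv_sym affS_equiv_trans.

Definition affS := {eq_quot affS_equiv}.

HB.instance Definition _ := Choice.on affS.

Definition affS_class (s : seq 'I_n) : affS := \pi_({eq_quot affS_equiv}) s.
Definition affS_repr (w : affS) : seq 'I_n :=
  generic_quotient.repr (w : {eq_quot affS_equiv}).

Lemma affS_reprK : cancel affS_repr affS_class.
Proof. by move=> w; rewrite /affS_class /affS_repr reprK. Qed.

Lemma affS_classP s t : affS_class s = affS_class t <-> affS_cong s t.
Proof.
split; first by move/eqmodP/asboolP.
by move=> st; apply/eqmodP/asboolP.
Qed.

Lemma affS_repr_class s : affS_cong (affS_repr (affS_class s)) s.
Proof. by apply/affS_classP; rewrite affS_reprK. Qed.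

Lemma affS_cong_cat a b c d :
  affS_cong a b -> affS_cong c d -> affS_cong (a ++ c) (b ++ d).
Proof.
move=> ab cd; apply: (@affS_cong_trans _ (b ++ c)).
  elim: ab => {a b} [a r s b rs|a|a b _ IH|a b e _ IH1 _ IH2].
  - by rewrite -!catA; apply: affS_cong_rel.
  - exact: affS_cong_refl.
  - exact: affS_cong_sym.
  - exact: affS_cong_trans IH2.
elim: cd => {c d} [x r s y rs|x|x y _ IH|x y e _ IH1 _ IH2].
- by rewrite !(catA b); apply: affS_cong_rel.
- exact: affS_cong_refl.
- exact: affS_cong_sym.
- exact: affS_cong_trans IH2.
Qed.

Lemma affS_rel_rev r s : affS_rel r s -> affS_cong (rev r) (rev s).
Proof.
have cg a b : affS_rel a b -> affS_cong a b.
  by move=> ab; rewrite -(cats0 a) -(cats0 b); apply: (@affS_cong_rel [::]).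
case=> [i|i n2|i j ij1 ij2 ij3]; rewrite /rev /=; apply: cg.
- exact: affS_involution.
- exact: affS_braid.
- by apply: affS_commute; rewrite // eq_sym.
Qed.

Lemma affS_cong_rev a b : affS_cong a b -> affS_cong (rev a) (rev b).
Proof.
elim=> {a b} [x r s y rs|x|x y _ IH|x y e _ IH1 _ IH2].
- rewrite !rev_cat; apply: affS_cong_cat (affS_cong_refl _).
  by apply: affS_cong_cat (affS_cong_refl _) _; apply: affS_rel_rev.
- exact: affS_cong_refl.
- exact: affS_cong_sym.
- exact: affS_cong_trans IH2.
Qed.

Lemma affS_cong_catV s : affS_cong (rev s ++ s) [::].
Proof.
elim: s => [|i s IH]; first exact: affS_cong_refl.
rewrite rev_cons -cats1 -catA /= -[in X in affS_cong X _]cat1s.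
apply: affS_cong_trans IH; rewrite -[in X in affS_cong _ X](cat0s s).
exact: (affS_cong_rel (rev s) s (affS_involution i)).
Qed.

Definition affS_one : affS := affS_class [::].
Definition affS_mul (u v : affS) : affS :=
  affS_class (affS_repr u ++ affS_repr v).
Definition affS_inv (u : affS) : affS := affS_class (rev (affS_repr u)).

Lemma affS_mul_class s t :
  affS_mul (affS_class s) (affS_class t) = affS_class (s ++ t).
Proof. by apply/affS_classP/affS_cong_cat; apply: affS_repr_class. Qed.

Lemma affS_mulA : associative affS_mul.
Proof.
move=> u v w; rewrite -(affS_reprK u) -(affS_reprK v) -(affS_reprK w).
by rewrite !affS_mul_class catA.
Qed.

Lemma affS_mul1 : left_id affS_one affS_mul.
Proof. by move=> u; rewrite -(affS_reprK u) affS_mul_class. Qed.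

Lemma affS_mulr1 : right_id affS_one affS_mul.
Proof. by move=> u; rewrite -(affS_reprK u) affS_mul_class cats0. Qed.

Lemma affS_mulV : left_inverse affS_one affS_inv affS_mul.
Proof.
move=> u; rewrite -{2}(affS_reprK u) affS_mul_class.
by apply/affS_classP; apply: affS_cong_catV.
Qed.

Lemma affS_mulrV : right_inverse affS_one affS_inv affS_mul.
Proof.
move=> u; rewrite -{1}(affS_reprK u) affS_mul_class.
apply/affS_classP; rewrite -{1}(revK (affS_repr u)).
exact: affS_cong_catV.
Qed.

HB.instance Definition _ := isGroup.Build affS
  affS_mulA affS_mul1 affS_mulr1 affS_mulV affS_mulrV.

Definition gen (i : 'I_n) : affS := affS_class [:: i].

Definition wordprod (s : seq 'I_n) : affS := \prod_(i <- s) gen i.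

Lemma affS_class_wordprod s : affS_class s = wordprod s.
Proof.
rewrite /wordprod; elim: s => [|i s IH]; first by rewrite big_nil.
by rewrite big_cons -IH -[_ * _]/(affS_mul _ _) affS_mul_class.
Qed.

Lemma ex_word_size (w : affS) :
  exists k, `[< exists2 s, wordprod s = w & size s = k >].
Proof.
exists (size (affS_repr w)); apply/asboolP; exists (affS_repr w) => //.
by rewrite -affS_class_wordprod affS_reprK.
Qed.

Definition len (w : affS) : nat := ex_minn (ex_word_size w).

Definition reduced_word (w : affS) (s : seq 'I_n) : Prop :=
  wordprod s = w /\ size s = len w.

Definition con (w : affS) : {set 'I_n} :=
  [set i | `[< exists2 s, reduced_word w s & i \in s >]].

(* w lies in the subgroup generated by the [gen i] with [i != x]; generators
   being involutions, products of generators suffice. *)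
Definition in_parabolic (x : 'I_n) (w : affS) : Prop :=
  exists2 s, wordprod s = w & x \notin s.

Definition cyc_dec_word (s : seq 'I_n) : Prop :=
  uniq s /\ forall j, ord_pred j \in s -> j \in s ->
    ~~ (index (ord_pred j) s < index j s)%N.

Definition cyc_dec (u : affS) : Prop :=
  exists2 s, cyc_dec_word s & u = wordprod s.

(* The cyclically decreasing element of content A; the default value 1 is only
   taken for A = [set: 'I_n]. *)
Definition cyc_dec_of (A : {set 'I_n}) : affS :=
  xget 1 [set u | cyc_dec u /\ con u = A]%classic.

(* A pair (u, v) stands for the factorization w = uv. *)
Definition factorizations (w : affS) : set (affS * affS) :=
  [set p | [/\ w = p.1 * p.2, cyc_dec p.1, cyc_dec p.2 &
               len w = (len p.2 + len p.1)%N]]%classic.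

(* The first part of the weight is the length of the right factor. *)
Definition weight (p : affS * affS) : int * int :=
  ((len p.2)%:Z, (len p.1)%:Z)%R.

(* [asc x] lists the letters other than x increasingly for the order
   x - 1 > x - 2 > ... > x + 1, and [rank x] is the position in that order. *)
Definition asc (x : 'I_n) : seq 'I_n := traject (@ordS n) (ordS x) n.-1.
Definition rank (x a : 'I_n) : nat := index a (asc x).

Fixpoint pair_letters (x : 'I_n) (bs : seq 'I_n) (C : {set 'I_n}) :
    {set 'I_n} * {set 'I_n} :=
  if bs is b :: bs' then
    if ohead [seq a <- asc x | (a \in C) && (rank x b < rank x a)%N] is Some a
    then pair_letters x bs' (C :\ a)
    else let: (L, R) := pair_letters x bs' C in (b |: L, R)
  else (finset.set0, C).

(* The unpaired elements of A and of C. *)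
Definition pairing (x : 'I_n) (A C : {set 'I_n}) : {set 'I_n} * {set 'I_n} :=
  pair_letters x [seq b <- rev (asc x) | b \in A] C.

Definition some_parabolic (w : affS) : Prop := exists y, in_parabolic y w.

Definition admissible (U V : {set 'I_n}) (b : 'I_n) : Prop :=
  exists t, [/\ (1 <= t)%N,
    (forall i, (1 <= i <= t)%N -> iter i (@ord_pred n) b \in U),
    (forall i, (i < t)%N -> iter i (@ord_pred n) b \in V),
    b \notin U & iter t (@ord_pred n) b \notin V].

(* x is a letter that may be fixed to define the pairing of p = (u, v): a
   missing generator if uv lies in some proper parabolic, and otherwise the
   letter written b in the construction of the initial pair (b - 1, b). *)
Definition pivot (p : affS * affS) (x : 'I_n) : Prop :=
  in_parabolic x (p.1 * p.2) \/
  ~ some_parabolic (p.1 * p.2) /\ admissible (con p.1) (con p.2) x.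

(* The pair (L_1, R_1) of unpaired letters of con(u) and con(v). *)
Definition unpaired (x : 'I_n) (p : affS * affS) : {set 'I_n} * {set 'I_n} :=
  if `[< some_parabolic (p.1 * p.2) >] then pairing x (con p.1) (con p.2)
  else pairing x (con p.1 :\ ord_pred x) (con p.2 :\ x).

Definition omin (x : 'I_n) (A : {set 'I_n}) : option 'I_n :=
  ohead [seq a <- asc x | a \in A].
Definition omax (x : 'I_n) (A : {set 'I_n}) : option 'I_n :=
  ohead [seq a <- rev (asc x) | a \in A].

(* The least i with b - i - 1 outside U, resp. with a + i + 1 outside V. *)
Definition run_down (U : {set 'I_n}) (b : 'I_n) : nat :=
  find (fun i => iter i.+1 (@ord_pred n) b \notin U) (iota 0 n).
Definition run_up (V : {set 'I_n}) (a : 'I_n) : nat :=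
  find (fun i => iter i.+1 (@ordS n) a \notin V) (iota 0 n).

(* [None] is the symbol 0. *)
Definition e1 (x : 'I_n) (p : affS * affS) : option (affS * affS) :=
  let U := con p.1 in let V := con p.2 in
  if omin x (unpaired x p).1 is Some b
  then Some (cyc_dec_of (U :\ b),
             cyc_dec_of (iter (run_down U b) (@ord_pred n) b |: V))
  else None.

Definition f1 (x : 'I_n) (p : affS * affS) : option (affS * affS) :=
  let U := con p.1 in let V := con p.2 in
  if omax x (unpaired x p).2 is Some a
  then Some (cyc_dec_of (iter (run_up V a) (@ordS n) a |: U),
             cyc_dec_of (V :\ a))
  else None.

End AffineSymmetricGroup.

Local Open Scope ring_scope.

Definition Qq := {fraction {poly rat}}.

HB.instance Definition _ := GRing.Field.on Qq.

Definition qpoly (p : {poly rat}) : Qq := FracField.tofrac p.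
Definition q : Qq := qpoly 'X.

Definition qint (k : nat) : Qq := (q ^+ k - q ^- k) / (q - q^-1).
Definition qfact (k : nat) : Qq := \prod_(1 <= i < k.+1) qint i.

(* The ring A_0 of rational functions that are regular at q = 0. *)
Definition regular0 (r : Qq) : Prop :=
  exists g h : {poly rat}, h.[0] != 0 /\ r = qpoly g / qpoly h.

Section QuantumSl2.
Variable M : lmodType Qq.

Record Uq_sl2_module (E F K Kinv : {linear M -> M}) : Prop := {
  Uq_KKinv : forall v, K (Kinv v) = v;
  Uq_KinvK : forall v, Kinv (K v) = v;
  Uq_KE : forall v, K (E (Kinv v)) = q ^+ 2 *: E v;
  Uq_KF : forall v, K (F (Kinv v)) = q ^- 2 *: F v;
  Uq_EF : forall v, E (F v) - F (E v) = (q - q^-1)^-1 *: (K v - Kinv v)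
}.

Definition weight_vector (K : {linear M -> M}) (m : int) (v : M) : Prop :=
  K v = q ^ m *: v.

Record integrable (E F K : {linear M -> M}) : Prop := {
  int_weights : forall v, exists (s : seq int) (y : int -> M),
    (forall m, weight_vector K m (y m)) /\ v = \sum_(m <- s) y m;
  int_fin_dim : forall m, exists s : seq M, forall v, weight_vector K m v ->
    exists c : nat -> Qq, v = \sum_(i < size s) c i *: s`_i;
  int_nilpE : forall v, exists k, iter k E v = 0;
  int_nilpF : forall v, exists k, iter k F v = 0
}.

Definition divpow (F : {linear M -> M}) (k : nat) (v : M) : M :=
  (qfact k)^-1 *: iter k F v.

(* An integrable module is spanned by the F^(k) u with u a highest weight
   vector of weight m and 0 <= k <= m, so these equations characterize the
   Kashiwara operators. *)
Definition kashiwara_operators (E F K et ft : {linear M -> M}) : Prop :=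
  forall (m : int) (k : nat) (u : M),
    weight_vector K m u -> E u = 0 -> (k%:Z <= m)%R ->
    ft (divpow F k u) = divpow F k.+1 u /\
    et (divpow F k u) = if k is k'.+1 then divpow F k' u else 0.

Definition modq (L : M -> Prop) (u v : M) : Prop :=
  exists2 z, L z & u - v = q *: z.

(* L is a free A_0-submodule of M with Q(q) (x) L = M. *)
Record free_lattice (L : M -> Prop) : Prop := {
  lat_0 : L 0;
  lat_add : forall u v, L u -> L v -> L (u + v);
  lat_scale : forall r u, regular0 r -> L u -> L (r *: u);
  lat_basis : exists (J : eqType) (x : J -> M),
    [/\ forall j, L (x j),
        forall u, L u -> exists (s : seq J) (c : J -> Qq),
          (forall j, regular0 (c j)) /\ u = \sum_(j <- s) c j *: x j,
        forall (s : seq J) (c : J -> Qq), uniq s ->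
          \sum_(j <- s) c j *: x j = 0 -> forall j, j \in s -> c j = 0 &
        forall u, exists (s : seq J) (c : J -> Qq),
          u = \sum_(j <- s) c j *: x j]
}.

Record crystal_lattice (K et ft : {linear M -> M}) (L : M -> Prop) : Prop := {
  lat_free : free_lattice L;
  lat_weights : forall u, L u -> exists (s : seq int) (y : int -> M),
    (forall m, L (y m) /\ weight_vector K m (y m)) /\ u = \sum_(m <- s) y m;
  lat_et : forall u, L u -> L (et u);
  lat_ft : forall u, L u -> L (ft u)
}.

(* The classes of the [v b], [b] in [B], form a basis over the rationals of
   L / q L, consisting of weight vectors and on which the Kashiwara operators
   induce [e] and [f]. *)
Record crystal_basis (K et ft : {linear M -> M}) (L : M -> Prop)
    (T : eqType) (B : set T) (e f : T -> option T) (wt : T -> int)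
    (v : T -> M) : Prop := {
  cb_in : forall b, B b -> L (v b);
  cb_weight : forall b, B b -> weight_vector K (wt b) (v b);
  cb_span : forall u, L u -> exists (s : seq T) (c : T -> rat),
    (forall b, b \in s -> B b) /\
    modq L u (\sum_(b <- s) qpoly (c b)%:P *: v b);
  cb_indep : forall (s : seq T) (c : T -> rat), uniq s ->
    (forall b, b \in s -> B b) ->
    modq L (\sum_(b <- s) qpoly (c b)%:P *: v b) 0 ->
    forall b, b \in s -> c b = 0;
  cb_e : forall b, B b -> modq L (et (v b)) (oapp v 0 (e b));
  cb_f : forall b, B b -> modq L (ft (v b)) (oapp v 0 (f b))
}.

End QuantumSl2.

Definition integrable_crystal_graph (T : eqType) (B : set T)
    (e f : T -> option T) (wt : T -> int) : Prop :=
  exists (M : lmodType Qq) (E F K Kinv et ft : {linear M -> M})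
         (L : M -> Prop) (v : T -> M),
    [/\ Uq_sl2_module E F K Kinv, integrable E F K,
        kashiwara_operators E F K et ft, crystal_lattice K et ft L &
        crystal_basis K et ft L B e f wt v].

Definition string_length (T : Type) (op : T -> option T) (b : T) (k : nat) :=
  iter k (obind op) (Some b) <> None /\ iter k.+1 (obind op) (Some b) = None.

(* Weights are pairs (beta_1, beta_2); the simple root is (1, -1), on which the
   coroot beta_1 - beta_2 takes the value 2. *)
Record crystal_axioms (T : Type) (B : set T) (e f : T -> option T)
    (wt : T -> int * int) : Prop := {
  cr_nonempty : exists b, B b;
  cr_e : forall b b', B b -> e b = Some b' -> B b';
  cr_f : forall b b', B b -> f b = Some b' -> B b';
  cr_ef : forall b b', B b -> B b' -> (f b = Some b' <-> e b' = Some b);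
  cr_wt_e : forall b b', B b -> e b = Some b' -> wt b' = wt b + (1, -1);
  cr_wt_f : forall b b', B b -> f b = Some b' -> wt b' = wt b - (1, -1);
  cr_strings : forall b, B b -> exists eps phi : nat,
    [/\ string_length e b eps, string_length f b phi &
        phi%:Z - eps%:Z = (wt b).1 - (wt b).2]
}.

Definition Uq_sl2_crystal (T : eqType) (B : set T) (e f : T -> option T)
    (wt : T -> int * int) : Prop :=
  crystal_axioms B e f wt /\
  integrable_crystal_graph B e f (fun b => (wt b).1 - (wt b).2).

(* Main.v *)
Require Import Defs.
From mathcomp Require Import all_boot all_order all_algebra all_fingroup.
From mathcomp Require Import boolp classical_sets zify ring.

Set Implicit Arguments.
Unset Strict Implicit.
Unset Printing Implicit Defensive.

Import Order.TTheory GRing.Theory Num.Theory.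

(** Let [d_U] be the cyclically decreasing element of content [U]. Acting on the integers by
    affine permutations, [d_U] sends [z] to [z - 1] if [z - 1] lies in [U] (modulo [n]) and
    otherwise to the first [y >= z] outside [U]. The half lines [{y | y <= z}] preserved by an
    element detect the letters it avoids; this gives the contents and lengths needed, and an
    intrinsic description of the admissible letters of [d_U d_V] shows that they depend only on
    the product.

    Call a position of type 1, 2 or 3 if it lies in [U] only, in [V] only or in both. Braid
    relations show that [d_U d_V] is not reduced if a pattern [k-1 \notin U],
    [k, ..., m-1 \in U :&: V], [m \notin V] occurs, and they transform [1 3^t] into [3^t 2] when
    the next position avoids [V] and the previous one avoids [U].

    The pairing is a bracketing, encoded by a height function: the smallest unpaired letter of
    [U] is the last minimum of the height and the largest unpaired letter of [V] its first
    minimum. Along the run of the minimum the configuration is exactly [1 3^t], resp. [3^t 2], so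
    the operators are these transformations; they lower, resp. raise the minimum by one and are
    inverse to each other. A finite crystal of this kind is a disjoint union of strings, realized
    by the module with basis [v_b], [E v_b = [phi b + 1] v_(e b)], [F v_b = [eps b + 1] v_(f b)]. *)

(** * Quantum integers and functions regular at zero *)

(** One letter [x] has to serve all factorizations of [w], although in the non-parabolic case
    admissibility is a condition on the contents of a single one. Hence the description of
    admissible letters by the product map; in its converse direction reducedness excludes spurious
    letters.

    The initial pair removed before pairing is harmless for the following reason. Cut the circle at
    [x], so that [x] occupies both ends [0] and [n] of a path. Then [x - 1] opens at [n - 1] and [x]
    closes at [n]; these brackets are adjacent, and deleting them changes no height. The height can
    thus be computed from the full contents, and both cases are treated at once.

    The path starts at 0 and ends at the difference of the lengths of [u] and [v]. Its distance from
    the minimum to the end is the length of the [e1]-string, that from the start to the minimum the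
    length of the [f1]-string.

    The coefficients of the module are those of the divided powers of a highest weight vector. With
    them the Kashiwara operators act on the basis exactly as [e] and [f], not only modulo [q]. *)

Section QuantumIntegers.
Local Open Scope ring_scope.
Local Notation qpoly := Defs.qpoly.

(** For [X = t ^ a] and [Y = t ^ b] this is [a+1][b] - [b+1][a] = [b-a], the relation behind the
    commutator of E and F on a string. *)
Lemma quantum_integer_identity (F : fieldType) (X Y t : F) : X != 0 -> Y != 0 -> t != 0 ->
  t - t^-1 != 0 ->
  (X * t - (X * t)^-1) / (t - t^-1) * ((Y - Y^-1) / (t - t^-1))
  - (Y * t - (Y * t)^-1) / (t - t^-1) * ((X - X^-1) / (t - t^-1))
  = (t - t^-1)^-1 * (Y / X - X / Y).
Proof.
move=> X0 Y0 t0 tt; field; rewrite X0 Y0 t0 /=.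
apply: contraNneq tt => e; rewrite -(mulfI t0 (_ : t * (t - t^-1) = t * 0)) //.
by rewrite mulrBr mulfV // mulr0.
Qed.

Section InfiniteOrder.
Variables (F : fieldType) (t : F).
Hypotheses (t0 : t != 0) (tk : forall k, (0 < k)%N -> t ^+ k != 1).

Lemma exprz_inj_of_infinite_order : injective (fun m : int => t ^ m).
Proof.
have key (m l : int) : m <= l -> t ^ m = t ^ l -> m = l.
  move=> ml e; have : t ^+ `|l - m|%N == 1.
    rewrite -[t ^+ _]/(t ^ `|l - m|%N%:Z) (_ : `|l - m|%N%:Z = l - m); last by lia.
    by rewrite expfzDr // -e -expfzDr // subrr.
  have [|k0] := posnP `|l - m|%N; first by lia.
  by rewrite (negbTE (tk k0)).
move=> m l /= e; case: (leP m l) => ml; first exact: key.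
by apply/esym/key => //; apply: ltW.
Qed.

Lemma exp_subV_neq0 k : (0 < k)%N -> t ^+ k - t ^- k != 0.
Proof.
move=> k0; rewrite subr_eq0; apply/eqP=> e.
have := tk (_ : (0 < k + k)%N); rewrite exprD {1}e mulVf ?expf_neq0 // eqxx.
by rewrite addn_gt0 k0 => /(_ isT).
Qed.

Lemma exp_subV0 : t ^+ 0 - t ^- 0 = 0.
Proof. by rewrite expr0 invr1 subrr. Qed.

Lemma exp_commutator (a b : nat) :
  (t ^+ a.+1 - t ^- a.+1) / (t - t^-1) * ((t ^+ b - t ^- b) / (t - t^-1))
  - (t ^+ b.+1 - t ^- b.+1) / (t - t^-1) * ((t ^+ a - t ^- a) / (t - t^-1))
  = (t - t^-1)^-1 * (t ^ (b%:Z - a%:Z) - t ^ (- (b%:Z - a%:Z))).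
Proof.
have tk0 k : t ^+ k != 0 by rewrite expf_neq0.
rewrite opprB !expfzDr // -!exprnP -!exprnN !exprSr.
apply: quantum_integer_identity => //; exact: (exp_subV_neq0 (ltn0Sn 0)).
Qed.
End InfiniteOrder.

Lemma qpolyD a b : qpoly (a + b) = qpoly a + qpoly b.
Proof. exact: rmorphD. Qed.

Lemma qpolyB a b : qpoly (a - b) = qpoly a - qpoly b.
Proof. exact: rmorphB. Qed.

Lemma qpolyM a b : qpoly (a * b) = qpoly a * qpoly b.
Proof. exact: rmorphM. Qed.

Lemma qpoly0 : qpoly 0 = 0. Proof. exact: rmorph0. Qed.

Lemma qpoly1 : qpoly 1 = 1. Proof. exact: rmorph1. Qed.

Lemma qpolyXn a k : qpoly (a ^+ k) = qpoly a ^+ k.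
Proof. exact: rmorphXn. Qed.

Lemma qpoly_eq0 a : (qpoly a == 0) = (a == 0).
Proof. exact: tofrac_eq0. Qed.

Lemma q_neq0 : q != 0.
Proof. by rewrite qpoly_eq0 polyX_eq0. Qed.

Lemma q_exp_neq1 k : (0 < k)%N -> q ^+ k != 1.
Proof.
move=> k0; rewrite -qpolyXn -qpoly1 -subr_eq0 -qpolyB qpoly_eq0 -size_poly_eq0.
by rewrite -[1]/(1%:P) size_XnsubC.
Qed.

Lemma regular0_poly g : regular0 (qpoly g).
Proof. by exists g, 1; rewrite hornerC oner_eq0 qpoly1 divr1. Qed.

Lemma regular0_0 : regular0 0.
Proof. by rewrite -qpoly0; apply: regular0_poly. Qed.

Lemma regular0_1 : regular0 1.
Proof. by rewrite -qpoly1; apply: regular0_poly. Qed.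

Lemma horner0_qpoly_neq0 h : h.[0] != 0 -> qpoly h != 0.
Proof. by rewrite qpoly_eq0; apply: contraNneq => ->; rewrite horner0. Qed.

Lemma regular0_add r s : regular0 r -> regular0 s -> regular0 (r + s).
Proof.
case=> g [h [h0 ->]] [g' [h' [h0' ->]]]; exists (g * h' + g' * h), (h * h'); split.
  by rewrite hornerM mulf_neq0.
by rewrite qpolyD !qpolyM addf_div ?horner0_qpoly_neq0.
Qed.

Lemma regular0_mul r s : regular0 r -> regular0 s -> regular0 (r * s).
Proof.
case=> g [h [h0 ->]] [g' [h' [h0' ->]]]; exists (g * g'), (h * h'); split.
  by rewrite hornerM mulf_neq0.
by rewrite !qpolyM mulf_div.
Qed.

Lemma regular0_sum (I : Type) (s : seq I) (P : pred I) (F : I -> Qq) :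
  (forall i, regular0 (F i)) -> regular0 (\sum_(i <- s | P i) F i).
Proof.
by move=> h; elim/big_ind: _ => //; [apply: regular0_0 | apply: regular0_add].
Qed.

(** [c] is the value of [r] at 0: [g - c h] vanishes there and is divisible by ['X], while [h] stays
    invertible. Together with [regular0_value0] this identifies A_0 / q A_0 with the rationals. *)
Lemma regular0_value r : regular0 r ->
  exists c : rat, exists2 s, regular0 s & r - qpoly c%:P = q * s.
Proof.
case=> g [h [h0 ->]]; pose c := g.[0] / h.[0].
have /factor_theorem[g' eg] : root (g - c%:P * h) 0.
  by rewrite /root hornerD hornerN hornerM hornerC divfK // subrr.
exists c, (qpoly g' / qpoly h); first by exists g', h.
have qh := horner0_qpoly_neq0 h0.
have -> : qpoly g / qpoly h - qpoly c%:P = (qpoly g - qpoly c%:P * qpoly h) / qpoly h.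
  by rewrite mulrBl mulfK.
by rewrite -qpolyM -qpolyB eg subr0 qpolyM mulrA [q * _]mulrC.
Qed.

Lemma regular0_value0 (c : rat) s : regular0 s -> qpoly c%:P = q * s -> c = 0.
Proof.
case=> g [h [h0 ->]] /(congr1 (fun r => r * qpoly h)).
rewrite -mulrA divfK ?horner0_qpoly_neq0 // -!qpolyM => /eqP.
rewrite -subr_eq0 -qpolyB qpoly_eq0 subr_eq0 => /eqP /(congr1 (fun p => p.[0])).
by rewrite !hornerM hornerC hornerX mul0r => /eqP; rewrite mulf_eq0 (negbTE h0) orbF => /eqP.
Qed.

End QuantumIntegers.

(** * The module of a finite disjoint union of strings *)

Section FreeModule.
Local Open Scope ring_scope.
Variables (R : fieldType) (T : eqType) (s : seq T).
Hypothesis us : uniq s.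
Local Notation N := (size s).

Definition elt (i : 'I_N) : T := tnth (in_tuple s) i.

Lemma elt_mem i : elt i \in s.
Proof. by have := mem_tnth i (in_tuple s). Qed.

Lemma elt_inj : injective elt.
Proof. exact/tuple_uniqP. Qed.

Lemma eltP b : b \in s -> exists i, b = elt i.
Proof. by move=> bs; apply/tnthP. Qed.

(** Defined on all of [T], with value zero outside [s], because a crystal basis is a family indexed
    by [T]. *)
Definition bvec (b : T) : 'rV[R]_N := \row_j (b == elt j)%:R.

Definition ovec (o : option T) : 'rV[R]_N := oapp bvec 0 o.

Definition blin (y : T -> 'rV[R]_N) : {linear 'rV[R]_N -> 'rV[R]_N} :=
  mulmxr (\matrix_(i < N) y (elt i)).

Lemma blin_sum y u : blin y u = \sum_i u 0 i *: y (elt i).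
Proof.
by rewrite /= mulmx_sum_row; apply: eq_bigr => i _; rewrite rowK.
Qed.

Lemma ovec_coord o j : ovec o 0 j = (o == Some (elt j))%:R.
Proof. by case: o => [b|]; rewrite /= ?mxE. Qed.

Lemma ovec_some b : ovec (Some b) = bvec b. Proof. by []. Qed.

Lemma ovec_none : ovec None = 0. Proof. by []. Qed.

Lemma bvec_sum (u : 'rV[R]_N) : u = \sum_i u 0 i *: bvec (elt i).
Proof.
apply/rowP=> j; rewrite summxE (bigD1 j) //= !mxE eqxx mulr1 big1 ?addr0 // => i ij.
by rewrite !mxE (inj_eq elt_inj) (negbTE ij) mulr0.
Qed.

Lemma blinE y b : b \in s -> blin y (bvec b) = y b.
Proof.
case/eltP=> i ->; rewrite blin_sum (bigD1 i) //= mxE eqxx scale1r big1 ?addr0 // => j ji.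
by rewrite mxE eq_sym (inj_eq elt_inj) (negbTE ji) scale0r.
Qed.

Lemma blin_diag_coord (c : T -> R) u j :
  blin (fun b => c b *: bvec b) u 0 j = c (elt j) * u 0 j.
Proof.
rewrite blin_sum summxE (bigD1 j) //= big1 ?addr0 => [|i ij].
  by rewrite !mxE eqxx mulr1 mulrC.
by rewrite !mxE (inj_eq elt_inj) (negbTE ij) !mulr0.
Qed.

Lemma linear_iter_sum (M : lmodType R) (g : {linear M -> M}) k (c : 'I_N -> R) (y : 'I_N -> M) :
  iter k g (\sum_i c i *: y i) = \sum_i c i *: iter k g (y i).
Proof.
elim: k => [//|k IH]; rewrite iterS IH linear_sum; apply: eq_bigr => i _.
by rewrite linearZ_LR.
Qed.

End FreeModule.

(** * The action of the quantum group on a union of strings *)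

Section StringModule.
Local Open Scope ring_scope.
Variables (R : fieldType) (t : R).
Hypotheses (t0 : t != 0) (tk : forall k, (0 < k)%N -> t ^+ k != 1).
Variables (T : eqType) (s : seq T) (e f : T -> option T) (eps phi : T -> nat) (wt : T -> int).
Hypothesis us : uniq s.
Hypotheses
  (e_some : forall b b', b \in s -> e b = Some b' ->
    [/\ b' \in s, f b' = Some b, eps b = (eps b').+1 & phi b' = (phi b).+1])
  (f_some : forall b b', b \in s -> f b = Some b' ->
    [/\ b' \in s, e b' = Some b, phi b = (phi b').+1 & eps b' = (eps b).+1])
  (e_none : forall b, b \in s -> e b = None -> eps b = 0%N)
  (f_none : forall b, b \in s -> f b = None -> phi b = 0%N)
  (wtE : forall b, b \in s -> wt b = (phi b)%:Z - (eps b)%:Z).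
Local Notation N := (size s).
Local Notation bvec := (bvec R s).
Local Notation ovec := (ovec R s).
Local Notation elt := (@elt T s).
Local Notation M := 'rV[R]_N.

Definition qn (k : nat) : R := (t ^+ k - t ^- k) / (t - t^-1).

Lemma qn0 : qn 0 = 0. Proof. by rewrite /qn (exp_subV0 t) mul0r. Qed.

Lemma t_subV_neq0 : t - t^-1 != 0. Proof. exact: (exp_subV_neq0 t0 tk (ltn0Sn 0)). Qed.

Lemma qn_neq0 k : qn k.+1 != 0.
Proof. by rewrite mulf_neq0 ?invr_neq0 ?t_subV_neq0 // (exp_subV_neq0 t0 tk). Qed.

(** On a string with v_k = F^(k) v_0, 0 <= k <= m, one has F v_k = [k+1] v_(k+1) and E v_k = [m-k+1]
    v_(k-1); here k is [eps] and m - k is [phi]. *)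
Definition opE : {linear M -> M} := blin (fun b => qn (phi b).+1 *: ovec (e b)).
Definition opF : {linear M -> M} := blin (fun b => qn (eps b).+1 *: ovec (f b)).
Definition opK : {linear M -> M} := blin (fun b => t ^ wt b *: bvec b).
Definition opKinv : {linear M -> M} := blin (fun b => t ^ (- wt b) *: bvec b).
Definition op_et : {linear M -> M} := blin (fun b => ovec (e b)).
Definition op_ft : {linear M -> M} := blin (fun b => ovec (f b)).

Lemma opEE b : b \in s -> opE (bvec b) = qn (phi b).+1 *: ovec (e b).
Proof. exact: blinE. Qed.
Lemma opFE b : b \in s -> opF (bvec b) = qn (eps b).+1 *: ovec (f b).
Proof. exact: blinE. Qed.
Lemma opKE b : b \in s -> opK (bvec b) = t ^ wt b *: bvec b.
Proof. exact: blinE. Qed.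
Lemma opKinvE b : b \in s -> opKinv (bvec b) = t ^ (- wt b) *: bvec b.
Proof. exact: blinE. Qed.

Lemma bvec_lin_ext (g h : M -> M) (lg : linear g) (lh : linear h) :
  (forall b, b \in s -> g (bvec b) = h (bvec b)) -> g =1 h.
Proof.
have lin0 (k : M -> M) : linear k -> k 0 = 0.
  by move=> lk; have := lk (-1) 0 0; rewrite scaler0 addr0 scaleN1r addNr.
move=> gh u; rewrite (bvec_sum us u); elim/big_ind: _ => [|v v' ev ev'|i _].
- by rewrite (lin0 g lg) (lin0 h lh).
- by have := lg 1 v v'; have := lh 1 v v'; rewrite !scale1r ev ev' => -> ->.
- have := lg (u 0 i) (bvec (elt i)) 0; have := lh (u 0 i) (bvec (elt i)) 0.
  by rewrite (lin0 g lg) (lin0 h lh) !addr0 gh ?elt_mem // => -> ->.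
Qed.

Lemma exprz_mulV (m : int) : t ^ m * t ^ (- m) = 1.
Proof. by rewrite -expfzDr // subrr. Qed.

Lemma opKKinv u : opK (opKinv u) = u.
Proof.
apply: (bvec_lin_ext (g := fun u => opK (opKinv u)) (h := id)).
- by move=> a x y; rewrite !linearP.
- by [].
move=> b bs; rewrite opKinvE // linearZ_LR opKE // scalerA mulrC exprz_mulV.
by rewrite scale1r.
Qed.

Lemma opKinvK u : opKinv (opK u) = u.
Proof.
apply: (bvec_lin_ext (g := fun u => opKinv (opK u)) (h := id)).
- by move=> a x y; rewrite !linearP.
- by [].
by move=> b bs; rewrite opKE // linearZ_LR opKinvE // scalerA exprz_mulV scale1r.
Qed.

Lemma wt_e b b' : b \in s -> e b = Some b' -> wt b' = wt b + 2.
Proof.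
move=> bs eb; have [b's _ h1 h2] := e_some bs eb.
by rewrite !wtE // h1 h2; lia.
Qed.

Lemma wt_f b b' : b \in s -> f b = Some b' -> wt b' = wt b - 2.
Proof.
move=> bs fb; have [b's _ h1 h2] := f_some bs fb.
by rewrite !wtE // h1 h2; lia.
Qed.

Lemma opKEK u : opK (opE (opKinv u)) = t ^+ 2 *: opE u.
Proof.
apply: (bvec_lin_ext (g := fun u => opK (opE (opKinv u))) (h := fun u => t ^+ 2 *: opE u)).
- by move=> a x y; rewrite !linearP.
- by move=> a x y; rewrite linearP scalerDr !scalerA mulrC.
move=> b bs; rewrite opKinvE // (linearZ_LR opE) (linearZ_LR opK) opEE // (linearZ_LR opK).
case eb : (e b) => [b'|]; rewrite ?ovec_some; last by rewrite ovec_none !linear0 ?scaler0.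
have [b's _ _ _] := e_some bs eb; rewrite opKE // (wt_e bs eb) !scalerA.
congr (_ *: _); rewrite expfzDr // -exprnP -[RHS]mul1r -(exprz_mulV (wt b)).
by move: (t ^ _) (t ^ _) (t ^+ _) (qn _) => ? ? ? ?; ring.
Qed.

Lemma opKFK u : opK (opF (opKinv u)) = t ^- 2 *: opF u.
Proof.
apply: (bvec_lin_ext (g := fun u => opK (opF (opKinv u))) (h := fun u => t ^- 2 *: opF u)).
- by move=> a x y; rewrite !linearP.
- by move=> a x y; rewrite linearP scalerDr !scalerA mulrC.
move=> b bs; rewrite opKinvE // (linearZ_LR opF) (linearZ_LR opK) opFE // (linearZ_LR opK).
case fb : (f b) => [b'|]; rewrite ?ovec_some; last by rewrite ovec_none !linear0 ?scaler0.
have [b's _ _ _] := f_some bs fb; rewrite opKE // (wt_f bs fb) !scalerA.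
congr (_ *: _); rewrite expfzDr // -exprnN -[RHS]mul1r -(exprz_mulV (wt b)).
by move: (t ^ _) (t ^ _) (t ^- _) (qn _) => ? ? ? ?; ring.
Qed.

(** Inside a string [phi (f b) + 1 = phi b]. At its bottom [f b = None] and [phi b = 0], and the
    factor [qn 0 = 0] keeps the formula valid. *)
Lemma opEF b : b \in s -> opE (opF (bvec b)) = (qn (eps b).+1 * qn (phi b)) *: bvec b.
Proof.
move=> bs; rewrite opFE // linearZ_LR; case fb : (f b) => [b'|]; rewrite ?ovec_some.
  have [b's eb' h1 h2] := f_some bs fb.
  by rewrite opEE // eb' ovec_some scalerA h1.
by rewrite ovec_none linear0 ?scaler0 (f_none bs fb) qn0 mulr0 scale0r.
Qed.

Lemma opFE' b : b \in s -> opF (opE (bvec b)) = (qn (phi b).+1 * qn (eps b)) *: bvec b.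
Proof.
move=> bs; rewrite opEE // linearZ_LR; case eb : (e b) => [b'|]; rewrite ?ovec_some.
  have [b's fb' h1 h2] := e_some bs eb.
  by rewrite opFE // fb' ovec_some scalerA h1.
by rewrite ovec_none linear0 ?scaler0 (e_none bs eb) qn0 mulr0 scale0r.
Qed.

Lemma opEF_commutator u :
  opE (opF u) - opF (opE u) = (t - t^-1)^-1 *: (opK u - opKinv u).
Proof.
apply: (bvec_lin_ext (g := fun u => opE (opF u) - opF (opE u))
  (h := fun u => (t - t^-1)^-1 *: (opK u - opKinv u))).
- move=> a x y; rewrite (linearP opF) (linearP opE) (linearP opE) (linearP opF).
  by rewrite scalerBr opprD addrACA.
- move=> a x y; rewrite (linearP opK) (linearP opKinv) opprD addrACA -scalerBr scalerDr !scalerA.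
  by rewrite [_^-1 * _]mulrC.
move=> b bs; rewrite opEF // opFE' // opKE // opKinvE // -!scalerBl scalerA.
by rewrite wtE // -(exp_commutator t0 tk).
Qed.

Definition weight_part (u : M) (m : int) : M := \row_j (if wt (elt j) == m then u 0 j else 0).

(** Duplicates are removed because each weight part already collects all basis vectors of its
    weight. *)
Definition weights : seq int := undup [seq wt b | b <- s].

Lemma weight_part_sum u : u = \sum_(m <- weights) weight_part u m.
Proof.
apply/rowP=> j; rewrite summxE.
under eq_bigr do rewrite mxE.
rewrite -big_mkcond -big_filter (_ : [seq m <- weights | wt (elt j) == m] = [:: wt (elt j)]).
  by rewrite big_seq1.
have -> : [seq m <- weights | wt (elt j) == m] = [seq m <- weights | pred1 (wt (elt j)) m].
  by apply: eq_filter => m; rewrite /= eq_sym.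
by apply: filter_pred1_uniq; rewrite ?undup_uniq // mem_undup map_f // elt_mem.
Qed.

Lemma opK_weight_part u m : opK (weight_part u m) = t ^ m *: weight_part u m.
Proof.
apply/rowP=> j; rewrite blin_diag_coord // !mxE.
by case: eqP => [->|_]; rewrite ?mulr0.
Qed.

Lemma weight_coord u m i : opK u = t ^ m *: u -> u 0 i != 0 -> wt (elt i) = m.
Proof.
move=> /rowP /(_ i); rewrite blin_diag_coord // mxE => h ui.
exact: (exprz_inj_of_infinite_order t0 tk (mulIf ui h)).
Qed.

(** [e] is injective where it is defined, since [f] undoes it, so the terms of [opE u] cannot
    cancel, and their coefficients [phi + 1] are nonzero. *)
Lemma highest_coord u i : opE u = 0 -> u 0 i != 0 -> e (elt i) = None.
Proof.
move=> Eu ui; case eb : (e (elt i)) => [b'|//]; exfalso.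
have [b's fb' _ _] := e_some (elt_mem i) eb.
have [j ej] := eltP b's.
have := congr1 (fun v : M => v 0 j) Eu; rewrite blin_sum summxE mxE (bigD1 i) //=.
rewrite big1 => [|k ki]; last first.
  rewrite mxE mxE ovec_coord; case: eqP => [ek|_]; last by rewrite !mulr0.
  have [_ fk _ _] := e_some (elt_mem k) ek.
  by move: fb'; rewrite ej fk => -[] /(elt_inj us) e1; rewrite e1 eqxx in ki.
rewrite addr0 mxE mxE ovec_coord eb -ej eqxx mulr1 => /eqP.
by rewrite mulf_eq0 (negbTE ui) (negbTE (qn_neq0 _)).
Qed.

Lemma f_string b k : b \in s -> (k <= phi b)%N -> exists b',
  [/\ b' \in s, iter k (obind f) (Some b) = Some b', eps b' = (eps b + k)%N &
      phi b = (phi b' + k)%N].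
Proof.
move=> bs; elim: k => [|k IH] kb; first by exists b; rewrite !addn0.
have [b' [b's eb h1 h2]] := IH (ltnW kb); case fb : (f b') => [b''|]; last first.
  by have := f_none b's fb; lia.
have [b''s _ h3 h4] := f_some b's fb; exists b''; split=> //; [|lia|lia].
by rewrite iterS eb /= fb.
Qed.

Lemma f_string_end b k : b \in s -> (phi b < k)%N -> iter k (obind f) (Some b) = None.
Proof.
move=> bs kb; have [b' [b's eb h1 h2]] := f_string bs (leqnn (phi b)).
have fb : f b' = None.
  by case fb : (f b') => [b''|//]; have [_ _ h3 _] := f_some b's fb; lia.
have -> : k = (k - (phi b).+1 + (phi b).+1)%N by lia.
by rewrite iterD iterS eb /= fb; elim: (k - _)%N => //= m ->.
Qed.

Lemma e_string_end b k : b \in s -> (eps b < k)%N -> iter k opE (bvec b) = 0.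
Proof.
elim: k b => // k IH b bs kb; rewrite iterSr opEE //.
have z m : iter m opE 0 = 0 by elim: m => // m; rewrite iterS => ->; rewrite linear0.
have zZ m c (y : M) : iter m opE (c *: y) = c *: iter m opE y.
  by elim: m => // m; rewrite !iterS => ->; rewrite linearZ_LR.
rewrite zZ; case eb : (e b) => [b'|]; rewrite ?ovec_some; last by rewrite ovec_none z scaler0.
have [b's _ h1 h2] := e_some bs eb.
by rewrite IH ?scaler0 //; lia.
Qed.

Definition qnfact (k : nat) : R := \prod_(1 <= i < k.+1) qn i.

Lemma qnfactS k : qnfact k.+1 = qnfact k * qn k.+1.
Proof. by rewrite /qnfact big_nat_recr. Qed.

Lemma qnfact_neq0 k : qnfact k != 0.
Proof.
elim: k => [|k IH]; first by rewrite /qnfact big_geq // oner_eq0.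
by rewrite qnfactS mulf_neq0 ?qn_neq0.
Qed.

(** From the top of a string on, [eps] runs through 0, 1, 2, ..., so the coefficients multiply up to
    the quantum factorial; dividing by it leaves a bare basis vector. *)
Lemma iter_opF b k : b \in s -> eps b = 0%N ->
  iter k opF (bvec b) = qnfact k *: ovec (iter k (obind f) (Some b)).
Proof.
move=> bs eb; elim: k => [|k IH]; first by rewrite /qnfact big_geq // scale1r.
rewrite !iterS IH linearZ_LR; have [kb|kb] := leqP k (phi b).
  have [b' [b's -> h1 _]] := f_string bs kb.
  by rewrite ovec_some opFE // scalerA h1 eb add0n qnfactS.
by rewrite f_string_end // ovec_none linear0 ?scaler0.
Qed.

Lemma iter_opF_end b k : b \in s -> (phi b < k)%N -> iter k opF (bvec b) = 0.
Proof.
elim: k b => // k IH b bs kb; rewrite iterSr opFE //.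
have z m : iter m opF 0 = 0 by elim: m => // m; rewrite iterS => ->; rewrite linear0.
have zZ m c (y : M) : iter m opF (c *: y) = c *: iter m opF y.
  by elim: m => // m; rewrite !iterS => ->; rewrite linearZ_LR.
rewrite zZ; case fb : (f b) => [b'|]; rewrite ?ovec_some; last by rewrite ovec_none z scaler0.
have [b's _ h1 h2] := f_some bs fb.
by rewrite IH ?scaler0 //; lia.
Qed.

Definition divpowF k (u : M) : M := (qnfact k)^-1 *: iter k opF u.

Lemma divpowF_bvec b k : b \in s -> eps b = 0%N ->
  divpowF k (bvec b) = ovec (iter k (obind f) (Some b)).
Proof.
by move=> bs eb; rewrite /divpowF iter_opF // scalerA mulVf ?qnfact_neq0 // scale1r.
Qed.

Lemma divpowF_sum k u : divpowF k u = \sum_i u 0 i *: divpowF k (bvec (elt i)).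
Proof.
rewrite /divpowF {1}(bvec_sum us u) linear_iter_sum scaler_sumr.
by apply: eq_bigr => i _; rewrite !scalerA mulrC.
Qed.

(** A highest weight vector of weight [m] is supported on tops of strings with [phi = m], which
    reduces everything to basis vectors. The bound [k <= m] keeps F^(k) inside the string; for
    [k = m + 1] the vector would be 0 and [op_et] could not recover F^(m). *)
Lemma ft_divpowF m k u : opK u = t ^ m *: u -> opE u = 0 -> (k%:Z <= m)%R ->
  op_ft (divpowF k u) = divpowF k.+1 u /\
  op_et (divpowF k u) = if k is k'.+1 then divpowF k' u else 0.
Proof.
move=> Ku Eu km.
have hi i : u 0 i != 0 -> eps (elt i) = 0%N /\ (k <= phi (elt i))%N.
  move=> ui; have eb := highest_coord Eu ui; have wb := weight_coord Ku ui.
  have ep := e_none (elt_mem i) eb; split=> //.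
  by move: wb; rewrite wtE ?elt_mem // ep; lia.
have op_ft_E b : b \in s -> op_ft (bvec b) = ovec (f b) by apply: blinE.
have op_et_E b : b \in s -> op_et (bvec b) = ovec (e b) by apply: blinE.
split.
  rewrite !divpowF_sum linear_sum; apply: eq_bigr => i _.
  have [->|/hi [ep kp]] := eqVneq (u 0 i) 0; first by rewrite !scale0r linear0.
  rewrite linearZ_LR !divpowF_bvec ?elt_mem // iterS.
  have [b' [b's -> _ _]] := f_string (elt_mem i) kp.
  by rewrite ovec_some op_ft_E.
case: k km hi => [|k] km hi.
  rewrite divpowF_sum linear_sum big1 // => i _.
  have [->|ui] := eqVneq (u 0 i) 0; first by rewrite scale0r linear0.
  have [ep kp] := hi i ui.
  rewrite linearZ_LR !divpowF_bvec ?elt_mem // [iter _ _ _]/= ovec_some op_et_E ?elt_mem //.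
  by rewrite (highest_coord Eu ui) ovec_none scaler0.
rewrite !divpowF_sum linear_sum; apply: eq_bigr => i _.
have [->|/hi [ep kp]] := eqVneq (u 0 i) 0; first by rewrite !scale0r linear0.
rewrite linearZ_LR !divpowF_bvec ?elt_mem // iterS.
have [b' [b's -> _ h]] := f_string (elt_mem i) (ltnW kp).
rewrite [obind _ _]/=; case fb : (f b') => [b''|].
  have [b''s eb'' _ _] := f_some b's fb.
  by rewrite !ovec_some op_et_E // eb'' ovec_some.
by have := f_none b's fb; lia.
Qed.

Lemma opE_nilpotent u : exists k, iter k opE u = 0.
Proof.
exists (\max_i eps (elt i)).+1; rewrite (bvec_sum us u) linear_iter_sum big1 // => i _.
by rewrite e_string_end ?elt_mem ?scaler0 // ltnS (leq_bigmax (F := fun i => eps (elt i))).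
Qed.

Lemma opF_nilpotent u : exists k, iter k opF u = 0.
Proof.
exists (\max_i phi (elt i)).+1; rewrite (bvec_sum us u) linear_iter_sum big1 // => i _.
by rewrite iter_opF_end ?elt_mem ?scaler0 // ltnS (leq_bigmax (F := fun i => phi (elt i))).
Qed.

End StringModule.

Section StringLength.
Variables (T : Type) (op : T -> option T).

Lemma string_length_none b k : op b = None -> string_length op b k -> k = 0.
Proof.
case: k => // k ob [h _]; case: h; rewrite iterSr /= ob.
by elim: k => //= k ->.
Qed.

Lemma string_length_some b b' k : op b = Some b' -> string_length op b k ->
  exists2 k', k = k'.+1 & string_length op b' k'.
Proof.
move=> ob; case: k => [[_]|k []]; first by rewrite /= ob.
by rewrite !iterSr /= ob -iterSr => h1 h2; exists k.
Qed.

Lemma string_length_unique b k k' : string_length op b k -> string_length op b k' -> k = k'.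
Proof.
have none j m : iter j (obind op) (Some b) = None -> (j <= m)%N ->
    iter m (obind op) (Some b) = None.
  by move=> h jm; rewrite -(subnK jm) iterD h; elim: (m - j)%N => //= i ->.
move=> [h1 h2] [h1' h2']; case: (ltngtP k k') => // lt.
  by case: h1'; apply: none h2 lt.
by case: h1; apply: none h2' lt.
Qed.

End StringLength.

(** * The crystal lattice spanned by the basis vectors *)

Section Lattice.
Local Open Scope ring_scope.
Variables (T : eqType) (s : seq T).
Hypothesis us : uniq s.
Local Notation N := (size s).
Local Notation elt := (@elt T s).
Local Notation bvec := (bvec Qq s).
Local Notation M := 'rV[Qq]_N.

Definition lattice (u : M) : Prop := forall j, regular0 (u 0 j).

Lemma lattice_bvec b : lattice (bvec b).
Proof. by move=> j; rewrite mxE; case: eqP => _; [apply: regular0_1 | apply: regular0_0]. Qed.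

Lemma lattice0 : lattice 0.
Proof. by move=> j; rewrite mxE; apply: regular0_0. Qed.

Lemma bvec_comb_coord (r : seq T) (c : T -> Qq) j : uniq r ->
  (\sum_(b <- r) c b *: bvec b) 0 j = if elt j \in r then c (elt j) else 0.
Proof.
move=> ur; rewrite summxE; case: ifP => jr.
  rewrite (bigD1_seq (elt j)) //= !mxE eqxx mulr1 big1 ?addr0 // => b bj.
  by rewrite !mxE (negbTE bj) mulr0.
rewrite big_seq big1 // => b br; rewrite !mxE; case: eqP => [e|_]; last by rewrite mulr0.
by rewrite -e br in jr.
Qed.

Lemma free_lattice_bvec : free_lattice lattice.
Proof.
split.
- exact: lattice0.
- by move=> u v hu hv j; rewrite mxE; apply: regular0_add.
- by move=> r u hr hu j; rewrite mxE; apply: regular0_mul.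
exists ('I_N : eqType), (fun j => bvec (elt j)); split.
- by move=> j; apply: lattice_bvec.
- by move=> u hu; exists (index_enum 'I_N), (fun j => u 0 j); split=> //; apply: bvec_sum.
- move=> r c ur e j jr; have := congr1 (fun v : M => v 0 j) e.
  rewrite summxE mxE (bigD1_seq j) //= !mxE eqxx mulr1 big1 ?addr0 // => i ij.
  by rewrite !mxE (inj_eq (elt_inj us)) (negbTE ij) mulr0.
- by move=> u; exists (index_enum 'I_N), (fun j => u 0 j); apply: bvec_sum.
Qed.

Lemma lattice_blin (e : T -> option T) u :
  lattice u -> lattice (blin (fun b => ovec Qq s (e b)) u).
Proof.
move=> hu j; rewrite blin_sum summxE; apply: regular0_sum => i.
rewrite mxE ovec_coord; apply: regular0_mul => //.
by case: eqP => _; [apply: regular0_1 | apply: regular0_0].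
Qed.

Lemma lattice_weight_part wt u m : lattice u -> lattice (weight_part wt u m).
Proof. by move=> hu j; rewrite mxE; case: eqP => _ //; apply: regular0_0. Qed.

Lemma lattice_span u : lattice u -> exists c : T -> rat,
  modq lattice u (\sum_(b <- s) Defs.qpoly (c b)%:P *: bvec b).
Proof.
move=> hu.
(* The coefficients must form a function on [T]: an element of [s] gets the value at 0 of its
   coordinate, any other gets 0. *)
have /boolp.choice[c hc] b : exists c : rat, forall i, elt i = b ->
    exists2 r, regular0 r & u 0 i - Defs.qpoly c%:P = q * r.
  have [bs|nbs] := boolP (b \in s); last first.
    by exists 0 => i eb; rewrite -eb elt_mem in nbs.
  have [i ->] := eltP bs; have [c hc] := regular0_value (hu i).
  by exists c => j /(elt_inj us) ->.
have /boolp.choice[z hz] i : exists r, regular0 r /\ u 0 i - Defs.qpoly (c (elt i))%:P = q * r.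
  by have [r h1 h2] := hc (elt i) i erefl; exists r.
exists c, (\row_i z i); first by move=> i; rewrite mxE; case: (hz i).
apply/rowP=> j; rewrite !mxE bvec_comb_coord // elt_mem.
by case: (hz j).
Qed.

Lemma lattice_indep (r : seq T) (c : T -> rat) : uniq r -> {subset r <= s} ->
  modq lattice (\sum_(b <- r) Defs.qpoly (c b)%:P *: bvec b) 0 ->
  forall b, b \in r -> c b = 0.
Proof.
move=> ur rs [z hz e] b br; have [j ej] := eltP (rs b br).
have := congr1 (fun v : M => v 0 j) e; rewrite subr0 bvec_comb_coord // -ej br mxE.
exact: regular0_value0 (hz j).
Qed.

(** Finite dimension of the whole space bounds all weight spaces at once. *)
Lemma rV_spanned : exists r : seq M, forall v, exists c : nat -> Qq,
  v = \sum_(i < size r) c i *: r`_i.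
Proof.
exists [seq bvec b | b <- s] => v.
exists (fun k => if insub k is Some i then v 0 i else 0).
rewrite -(big_mkord xpredT (fun k => (if insub k is Some i then v 0 i else 0)
  *: [seq bvec b | b <- s]`_k)) size_map big_mkord {1}(bvec_sum us v).
apply: eq_bigr => i _; rewrite valK; congr (_ *: _).
rewrite (nth_map (elt i)) //; congr bvec.
exact: tnth_nth.
Qed.

End Lattice.

Lemma finite_crystal_integrable (T : eqType) (B : set T) (s : seq T)
    (e f : T -> option T) (wt : T -> int * int) :
  uniq s -> (forall b, B b <-> b \in s) -> crystal_axioms B e f wt ->
  integrable_crystal_graph B e f (fun b => (wt b).1 - (wt b).2)%R.
Proof.
move=> us Bs [_ hBe hBf hef _ _ hstr].
(* The axioms only assert that string lengths exist; they are made into functions, with default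
   value 0 outside [B]. *)
have /boolp.choice[eps heps] b : exists k, B b -> string_length e b k.
  have [/hstr[k [? [h _ _]]]|nB] := pselect (B b); first by exists k.
  by exists 0.
have /boolp.choice[phi hphi] b : exists k, B b -> string_length f b k.
  have [/hstr[? [k [_ h _]]]|nB] := pselect (B b); first by exists k.
  by exists 0.
have wtE b : b \in s -> ((wt b).1 - (wt b).2 = (phi b)%:Z - (eps b)%:Z)%R.
  move=> /Bs bB; have [k [l [h1 h2 <-]]] := hstr b bB.
  rewrite (string_length_unique (heps b bB) h1).
  by rewrite (string_length_unique (hphi b bB) h2).
have e_none b : b \in s -> e b = None -> eps b = 0.
  by move=> /Bs bB eb; apply: string_length_none eb (heps b bB).
have f_none b : b \in s -> f b = None -> phi b = 0.
  by move=> /Bs bB fb; apply: string_length_none fb (hphi b bB).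
have step b b' : B b -> B b' -> e b = Some b' -> f b' = Some b ->
    eps b = (eps b').+1 /\ phi b' = (phi b).+1.
  move=> bB bB' eb fb; split.
    have [k -> hk] := string_length_some eb (heps b bB).
    by rewrite (string_length_unique hk (heps b' bB')).
  have [k -> hk] := string_length_some fb (hphi b' bB').
  by rewrite (string_length_unique hk (hphi b bB)).
have e_some b b' : b \in s -> e b = Some b' ->
    [/\ b' \in s, f b' = Some b, eps b = (eps b').+1 & phi b' = (phi b).+1].
  move=> /Bs bB eb; have bB' := hBe b b' bB eb.
  have fb : f b' = Some b by apply/hef.
  by have [h1 h2] := step b b' bB bB' eb fb; split=> //; apply/Bs.
have f_some b b' : b \in s -> f b = Some b' ->
    [/\ b' \in s, e b' = Some b, phi b = (phi b').+1 & eps b' = (eps b).+1].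
  move=> /Bs bB fb; have bB' := hBf b b' bB fb.
  have eb : e b' = Some b by apply/hef.
  by have [h1 h2] := step b' b bB' bB eb fb; split=> //; apply/Bs.
pose w b := ((wt b).1 - (wt b).2)%R.
have h0 := q_neq0; have hk := q_exp_neq1.
exists 'rV[Qq]_(size s), (opE q s e phi), (opF q s f eps), (opK q s w), (opKinv q s w),
  (op_et Qq s e), (op_ft Qq s f), (@lattice T s), (bvec Qq s); split.
- split.
  + exact: opKKinv.
  + exact: opKinvK.
  + exact: (opKEK h0 us e_some wtE).
  + exact: (opKFK h0 us f_some wtE).
  + exact: (opEF_commutator h0 hk us e_some f_some e_none f_none wtE).
- split.
  + move=> v; exists (weights s w), (weight_part w v); split; last exact: weight_part_sum.
    exact: opK_weight_part.
  + move=> m; have [r hr] := rV_spanned us; exists r => v _; exact: hr.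
  + exact: (opE_nilpotent _ us e_some).
  + exact: (opF_nilpotent _ us f_some).
- move=> m k u Ku Eu km.
  exact: (ft_divpowF h0 hk us e_some f_some e_none f_none wtE Ku Eu km).
- split.
  + exact: free_lattice_bvec.
  + move=> u hu; exists (weights s w), (weight_part w u); split; last exact: weight_part_sum.
    by move=> m; split; [apply: lattice_weight_part | apply: opK_weight_part].
  + by move=> u; apply: lattice_blin.
  + by move=> u; apply: lattice_blin.
- split.
  + by move=> b _; apply: lattice_bvec.
  + by move=> b /Bs bs; apply: opKE.
  + move=> u hu; have [c hc] := lattice_span us hu; exists s, c; split=> // b.
    by move=> /Bs.
  + move=> r c ur rB h; have rs : {subset r <= s} by move=> b /rB /Bs.
    exact: (lattice_indep ur rs h).
  (* Basis vectors go exactly to basis vectors or to zero, so the remainder in q L is zero. *)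
  + move=> b /Bs bs; exists 0%R; first exact: lattice0.
    by rewrite /op_et blinE // subrr scaler0.
  + move=> b /Bs bs; exists 0%R; first exact: lattice0.
    by rewrite /op_ft blinE // subrr scaler0.
Qed.

(** * Affine permutations *)

Section Residues.
Local Open Scope ring_scope.
Variables (n : nat) (hn : (1 < n)%N).

Fact residue_proof (z : int) : (`|(z %% n%:Z)%Z| < n)%N.
Proof.
have n0 : n%:Z != 0 by lia.
have := modz_ge0 z n0; have := ltz_pmod z (_ : 0 < n%:Z).
by move: (z %% n)%Z => y; lia.
Qed.

Definition residue (z : int) : 'I_n := Ordinal (residue_proof z).

Lemma residueE z : (residue z)%:Z = (z %% n)%Z.
Proof.
have n0 : n%:Z != 0 by lia.
by rewrite /= gez0_abs // modz_ge0.
Qed.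

Lemma eq_residue z y : (residue z == residue y) = (z == y %[mod n])%Z.
Proof.
by apply/eqP/eqP => [e|e]; [rewrite -!residueE e | apply/val_inj => /=; rewrite e].
Qed.

Lemma residue_nat (i : 'I_n) : residue i%:Z = i.
Proof. by apply/val_inj; rewrite /= modz_nat absz_nat modn_small. Qed.

Lemma residueS z : residue (z + 1) = ordS (residue z).
Proof.
apply/val_inj => /=; apply/eqP; rewrite -eqz_nat; apply/eqP.
rewrite -modz_nat -addn1 PoszD gez0_abs ?modz_ge0 //; last by lia.
rewrite gez0_abs ?modz_ge0 //; last by lia.
by rewrite modzDml.
Qed.

Lemma residueB z : residue (z - 1) = ord_pred (residue z).
Proof. by rewrite -{2}(subrK 1 z) residueS ordSK. Qed.

Lemma residue_addn z k : residue (z + k%:Z) = iter k (@ordS n) (residue z).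
Proof.
elim: k => [|k IH]; first by rewrite addr0.
by rewrite iterS -IH -residueS; congr residue; lia.
Qed.

Lemma residue_subn z k : residue (z - k%:Z) = iter k (@ord_pred n) (residue z).
Proof.
elim: k => [|k IH]; first by rewrite subr0.
by rewrite iterS -IH -residueB; congr residue; lia.
Qed.

Lemma residue_period z : residue (z + n%:Z) = residue z.
Proof. by apply/eqP; rewrite eq_residue modzDr. Qed.

Lemma residue_neq z y : z < y < z + n%:Z -> residue z != residue y.
Proof.
move=> h; apply/eqP=> e; move/eqP: e; rewrite eq_sym eq_residue eqz_mod_dvd.
case/dvdzP=> k e; case: (ltrP k 1) => k1; nia.
Qed.

Lemma residue_inj_small z y :
  residue z = residue y -> z - n%:Z < y < z + n%:Z -> z = y.
Proof.
move=> e h; case: (ltgtP z y) => // zy.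
  by have := @residue_neq z y; rewrite e eqxx; lia.
by have := @residue_neq y z; rewrite e eqxx; lia.
Qed.

Lemma residue_surj_above (i : 'I_n) z : exists2 y, residue y = i & z <= y < z + n%:Z.
Proof.
have n0 : n%:Z != 0 by lia.
exists (z + ((i%:Z - z) %% n)%Z).
  apply: (@etrans _ _ (residue i%:Z)); last exact: residue_nat.
  by apply/eqP; rewrite eq_residue modzDmr addrC subrK.
have := modz_ge0 (i%:Z - z) n0; have := ltz_pmod (i%:Z - z) (_ : 0 < n%:Z).
by move: (_ %% _)%Z => k; lia.
Qed.

Lemma residue_surj_below (i : 'I_n) z : exists2 y, residue y = i & z - n%:Z < y <= z.
Proof. by have [y ey h] := residue_surj_above i (z - n%:Z + 1); exists y => //; lia. Qed.

(** The affine transposition exchanging [z] and [z + 1] for every [z] congruent to [i]. *)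
Definition act_gen (i : 'I_n) (z : int) : int :=
  if residue z == i then z + 1 else if residue (z - 1) == i then z - 1 else z.

Definition act_word (s : seq 'I_n) (z : int) : int := foldr act_gen z s.

Lemma act_word_cat s t z : act_word (s ++ t) z = act_word s (act_word t z).
Proof. by rewrite /act_word foldr_cat. Qed.

Lemma residue_succ_neq z : (residue (z + 1) == residue z) = false.
Proof. by rewrite eq_sym; apply/negbTE/residue_neq; lia. Qed.

Lemma residue_eqB i z : (residue (z - 1) == i) = (residue z == ordS i).
Proof. by rewrite residueB; apply/eqP/eqP=> [<-|->]; rewrite ?ord_predK ?ordSK. Qed.

Lemma ordS_neq (i : 'I_n) : (ordS i == i) = false.
Proof. by rewrite -(residue_nat i) -residueS residue_succ_neq. Qed.

Lemma ordSS_neq (i : 'I_n) : (2 < n)%N -> (ordS (ordS i) == i) = false.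
Proof.
move=> n2; rewrite -(residue_nat i) -!residueS eq_sym.
by apply/negbTE/residue_neq; lia.
Qed.

Lemma act_genE i z : act_gen i z =
  if residue z == i then z + 1 else if residue z == ordS i then z - 1 else z.
Proof. by rewrite /act_gen residue_eqB. Qed.

(** Only residues equal or next to the letters involved are moved, so it suffices to go through the
    residue of [z]. In the braid relation [2 < n] keeps [i] and [i + 2] apart. *)
Lemma act_rel r s z : affS_rel r s -> act_word r z = act_word s z.
Proof.
case=> [i|i n2|i j ji jSi iSj] /=; rewrite /act_word /=.
- rewrite [act_gen i z]act_genE; case: eqP => [ez|nz].
    by rewrite act_genE residueS ez ordS_neq eqxx addrK.
  case: eqP => [ez|nz'].
    by rewrite act_genE residueB ez ordSK eqxx subrK.
  by rewrite act_genE; do 2!case: eqP => //.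
- rewrite [act_gen i z]act_genE [act_gen (ordS i) z]act_genE.
  have [ez|nz] := eqVneq (residue z) i.
    rewrite ez [i == ordS i]eq_sym ordS_neq [i == ordS _]eq_sym ordSS_neq //.
    rewrite [act_gen i z]act_genE ez eqxx.
    rewrite [act_gen (ordS i) (z + 1)]act_genE residueS ez eqxx.
    by rewrite act_genE !residueS ez ordSS_neq // (inj_eq (can_inj (@ordSK n))) ordS_neq.
  have [ez|nz1] := eqVneq (residue z) (ordS i).
    rewrite [act_gen (ordS i) (z - 1)]act_genE residueB ez ordSK eq_sym ordS_neq.
    rewrite [i == ordS _]eq_sym ordSS_neq //.
    rewrite [act_gen i (z - 1)]act_genE residueB ez ordSK eqxx subrK.
    rewrite [act_gen i (z + 1)]act_genE !residueS ez ordSS_neq //.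
    rewrite (inj_eq (can_inj (@ordSK n))) ordS_neq.
    by rewrite act_genE residueS ez (inj_eq (can_inj (@ordSK n))) ordS_neq eqxx addrK.
  have [ez|nz2] := eqVneq (residue z) (ordS (ordS i)).
    rewrite [act_gen (ordS i) z]act_genE ez (inj_eq (can_inj (@ordSK n))) ordS_neq eqxx.
    rewrite [act_gen i (z - 1)]act_genE residueB ez ordSK ordS_neq eqxx.
    rewrite act_genE !residueB ez !ordSK eq_sym ordS_neq.
    by rewrite eq_sym ordSS_neq.
  rewrite [act_gen (ordS i) z]act_genE (negbTE nz1) (negbTE nz2).
  rewrite [act_gen i z]act_genE (negbTE nz) (negbTE nz1).
  by rewrite act_genE (negbTE nz1) (negbTE nz2).
- have SS := inj_eq (can_inj (@ordSK n)).
  have ij : (i == j) = false by rewrite eq_sym (negbTE ji).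
  have Sij : (ordS i == j) = false by rewrite eq_sym (negbTE jSi).
  have Sji : (ordS j == i) = false by rewrite eq_sym (negbTE iSj).
  have iSi : (i == ordS i) = false by rewrite eq_sym ordS_neq.
  have jSj : (j == ordS j) = false by rewrite eq_sym ordS_neq.
  have E := (SS, ij, negbTE ji, Sij, negbTE jSi, Sji, negbTE iSj, iSi, jSj,
    ordS_neq, residueS, residueB, ordSK, eqxx).
  rewrite ![act_gen _ z]act_genE.
  have [ez|nz] := eqVneq (residue z) i; first by rewrite ?ez ?E !act_genE ?E ez ?E.
  have [ez|nz1] := eqVneq (residue z) (ordS i).
    by rewrite ?ez ?E !act_genE ?E ez ?E.
  have [ez|nz2] := eqVneq (residue z) j; first by rewrite !act_genE ?E ez ?E.
  have [ez|nz3] := eqVneq (residue z) (ordS j).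
    by rewrite !act_genE ?E ez ?E.
  by rewrite !act_genE (negbTE nz) (negbTE nz1) (negbTE nz2) (negbTE nz3).
Qed.

Lemma act_cong r s z : affS_cong r s -> act_word r z = act_word s z.
Proof.
move=> h; elim: h z => {r s} [a r s b rs|//|a b _ IH|a b c _ IH1 _ IH2] z.
- by rewrite !act_word_cat (act_rel _ rs).
- by rewrite IH.
- by rewrite IH1 IH2.
Qed.

Lemma act_wordprod r s z : wordprod r = wordprod s -> act_word r z = act_word s z.
Proof. by rewrite -!affS_class_wordprod => /affS_classP/act_cong. Qed.

End Residues.

(** * Cyclically decreasing words *)

Section CyclicallyDecreasing.
Local Open Scope ring_scope.
Variables (n : nat) (hn : (1 < n)%N).
Local Notation residue := (residue hn).
Local Notation act_word := (act_word hn).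

Definition not_succ : rel 'I_n := fun a b => b != ordS a.

Lemma cyc_dec_wordP (s : seq 'I_n) : cyc_dec_word s <-> uniq s /\ pairwise not_succ s.
Proof.
split=> [[us h]|[us /(pairwiseP (Ordinal (ltnW hn))) h]]; split=> //.
  apply/(pairwiseP (Ordinal (ltnW hn))) => i j; rewrite !inE => si sj ij.
  apply/eqP=> e; set x0 := Ordinal _ in e.
  have := h (nth x0 s j); rewrite e ordSK -e !mem_nth // => /(_ isT isT).
  by rewrite !index_uniq // ij.
move=> j pj sj; apply/negP=> lt.
have := h (index (ord_pred j) s) (index j s); rewrite !inE !index_mem.
by move=> /(_ pj sj lt); rewrite /not_succ !nth_index // ord_predK eqxx.
Qed.

Lemma wordprod_cons i (s : seq 'I_n) : wordprod (i :: s) = (gen i * wordprod s)%g.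
Proof. by rewrite /wordprod big_cons. Qed.

Lemma wordprod_cat (s t : seq 'I_n) : wordprod (s ++ t) = (wordprod s * wordprod t)%g.
Proof. by rewrite /wordprod big_cat. Qed.

Lemma wordprod_nil : wordprod [::] = 1%g :> affS n.
Proof. by rewrite /wordprod big_nil. Qed.

Lemma wordprod_rel (r s : seq 'I_n) : affS_rel r s -> wordprod r = wordprod s.
Proof.
move=> rs; rewrite -!affS_class_wordprod; apply/affS_classP.
by rewrite -(cats0 r) -(cats0 s); apply: (@affS_cong_rel _ [::]).
Qed.

Lemma genK (i : 'I_n) : (gen i * gen i = 1)%g.
Proof.
have := wordprod_rel (affS_involution i).
by rewrite !wordprod_cons wordprod_nil mulg1.
Qed.

Lemma gen_braid (i : 'I_n) : (2 < n)%N ->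
  (gen i * gen (ordS i) * gen i = gen (ordS i) * gen i * gen (ordS i))%g.
Proof.
move=> n2; have := wordprod_rel (affS_braid i n2).
by rewrite !wordprod_cons !wordprod_nil !mulg1 !mulgA.
Qed.

Lemma gen_comm (i j : 'I_n) : j != ordS i -> i != ordS j ->
  (gen i * gen j = gen j * gen i)%g.
Proof.
move=> ji ij; have [->//|d] := eqVneq j i.
by have := wordprod_rel (affS_commute d ji ij); rewrite !wordprod_cons !wordprod_nil !mulg1.
Qed.

Lemma gen_comm_word i (s : seq 'I_n) :
  {in s, forall j, (j != ordS i) && (i != ordS j)} ->
  (gen i * wordprod s = wordprod s * gen i)%g.
Proof.
elim: s => [|j s IH] h; first by rewrite wordprod_nil mulg1 mul1g.
have /andP [h1 h2] := h j (mem_head _ _).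
rewrite wordprod_cons mulgA gen_comm // -mulgA IH ?mulgA // => k ks.
by apply: h; rewrite inE ks orbT.
Qed.

(** The first letter [i] of [s] can be moved to the front of [t]: a letter [j] before it in [t]
    satisfies [i != j + 1] because [t] is decreasing, and [j != i + 1] because [j] comes after [i]
    in [s]. So the two letters commute. *)
Lemma cyc_dec_word_eq (s t : seq 'I_n) :
  cyc_dec_word s -> cyc_dec_word t -> s =i t -> wordprod s = wordprod t.
Proof.
elim: s t => [|i s IH] t.
  by move=> _ _; case: t => // j t /(_ j); rewrite inE mem_head.
case/cyc_dec_wordP=> us ps /cyc_dec_wordP[ut pt] st.
have it : i \in t by rewrite -st mem_head.
move: it st ut pt => /splitPr[t1 t2] st ut pt.
move: us ps; rewrite /= => /andP[ni us] /andP[/allP ps1 ps2].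
move: ut; rewrite cat_uniq /= => /and4P[ut1 h ni2 ut2].
move: pt; rewrite pairwise_cat /= => /and4P[/allrelP r pt1 r2 pt2].
have nt1 : i \notin t1 by move: h; rewrite negb_or => /andP[].
rewrite wordprod_cons (IH (t1 ++ t2)); last first.
- move=> j; have := st j; rewrite !inE !mem_cat inE.
  have [->|ji] /= := eqVneq j i; last by [].
  by rewrite (negbTE ni) (negbTE nt1) (negbTE ni2).
- apply/cyc_dec_wordP; rewrite cat_uniq ut1 ut2 pairwise_cat pt1 pt2 andbT /=.
  split.
    apply/hasPn=> j j2; apply/negP => j1; move/negP: h; apply.
    by apply/orP; right; apply/hasP; exists j.
  rewrite andbT; apply/allrelP=> a b a1 b2; apply: r => //.
  by rewrite inE b2 orbT.
- by apply/cyc_dec_wordP.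
rewrite !wordprod_cat wordprod_cons !mulgA; congr (_ * _)%g.
apply: gen_comm_word => j j1; apply/andP; split; last exact: r (mem_head _ _).
have /ps1 : j \in s; last by [].
have := st j; rewrite !inE mem_cat j1 /= => /orP[/eqP e|//].
by rewrite -e j1 in nt1.
Qed.

Lemma cyc_dec_word_subseq (s t : seq 'I_n) : subseq s t -> cyc_dec_word t -> cyc_dec_word s.
Proof.
move=> st /cyc_dec_wordP[ut pt]; apply/cyc_dec_wordP; split.
  exact: subseq_uniq st ut.
exact: subseq_pairwise st pt.
Qed.

Record decreasing_map (U : int -> bool) (d : int -> int) : Prop := {
  dec_down : forall z : int, U (z - 1) -> d z = z - 1;
  dec_up : forall z : int, ~~ U (z - 1) ->
    [/\ z <= d z, forall y : int, z <= y < d z -> U y & ~~ U (d z)] }.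

Definition zset (U : {set 'I_n}) (z : int) : bool := residue z \in U.

(** The first letter [i] acts last, and [i + 1] does not occur in the tail. A point moved down by
    the tail lands neither on [i] nor on [i + 1]. A point moved up and stopping at [i] is pushed one
    step further and stops there; it could stop at [i + 1] only by starting there, which is the
    descending case. *)
Lemma act_cyc_dec_word s : cyc_dec_word s ->
  decreasing_map (fun z => residue z \in s) (act_word s).
Proof.
elim: s => [|i s IH].
  by move=> _; split=> // z _; have -> : act_word [::] z = z by []; split => // y; lia.
case/cyc_dec_wordP=> /= /andP[ni us] /andP[/allP ps1 ps2].
have {IH} [dn up] : decreasing_map (fun z => residue z \in s) (act_word s).
  by apply: IH; apply/cyc_dec_wordP.
have nSi : ordS i \notin s.
  by apply/negP=> /ps1; rewrite /not_succ eqxx.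
split=> z; rewrite inE.
  case/orP=> [/eqP ez|zs]; rewrite /act_word /=.
    have ezS : residue z = ordS i by rewrite -ez -residueS subrK.
    have nz : residue (z - 1) \notin s by rewrite ez.
    have [h1 h2 _] := up z nz.
    have e : act_word s z = z.
      apply/eqP; rewrite eq_le h1 andbT leNgt; apply/negP=> lt.
      by have := h2 z; rewrite lexx lt ezS => /(_ isT); rewrite (negbTE nSi).
    rewrite -/(act_word s z) e act_genE ezS eqxx.
    by rewrite ordS_neq.
  rewrite -/(act_word s z) (dn z zs) act_genE.
  case: eqP => [e|_]; first by rewrite e (negbTE ni) in zs.
  by case: eqP => [e|//]; rewrite e (negbTE nSi) in zs.
rewrite negb_or => /andP[zi zs]; rewrite /act_word /= -/(act_word s z).
have [h1 h2 h3] := up z zs; move: (act_word s z) h1 h2 h3 => y h1 h2 h3.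
rewrite act_genE; case: eqP => [ey|ny].
  split; first by lia.
    move=> x hx; rewrite inE; have [->|xy] := eqVneq x y; first by rewrite ey eqxx.
    by rewrite h2 ?orbT //; lia.
  by rewrite residueS ey inE ordS_neq.
rewrite -residue_eqB; case: eqP => [ey|ny'].
  exfalso; have [e|ne] := eqVneq y z; first by rewrite e in ey; rewrite ey eqxx in zi.
  by have := h2 (y - 1); rewrite ey (negbTE ni) => /(_ _)/notF; apply; lia.
split=> //; first by move=> x hx; rewrite inE h2 ?orbT.
by rewrite inE negb_or h3 andbT; apply/eqP.
Qed.

Lemma act_gen_le x z0 z i : residue z0 = x -> i != x ->
  (act_gen hn i z <= z0) = (z <= z0).
Proof.
move=> e0 ix; rewrite /act_gen; case: eqP => [e|_].
  have : z != z0 by apply/eqP=> h; rewrite -e h e0 eqxx in ix.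
  by lia.
case: eqP => [e|_ //].
have : z - 1 != z0 by apply/eqP=> h; rewrite -e h e0 eqxx in ix.
by lia.
Qed.

Lemma act_word_le s z0 z : residue z0 \notin s -> (act_word s z <= z0) = (z <= z0).
Proof.
elim: s => //= i s IH; rewrite inE negb_or => /andP[zi zs].
rewrite (@act_gen_le (residue z0)) //; first exact: IH.
by rewrite eq_sym.
Qed.

(** A word without the letter [x] preserves the half line up to [x], whereas [s] moves [x + 1] down
    to [x]. Consequently [s] is reduced and its letters are the content of its product. *)
Lemma cyc_dec_word_sub (s t : seq 'I_n) : cyc_dec_word s -> wordprod t = wordprod s -> {subset s <= t}.
Proof.
move=> /act_cyc_dec_word[dn _] e x xs; apply/negPn/negP=> xt.
rewrite -(residue_nat hn x) in xs xt.
have := act_word_le (x%:Z + 1) xt.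
by rewrite (act_wordprod hn _ e) dn addrK // lexx; lia.
Qed.

Lemma len_le_size (s : seq 'I_n) : (len (wordprod s) <= size s)%N.
Proof.
rewrite /len; case: ex_minnP => k _; apply; apply/asboolP; by exists s.
Qed.

Lemma ex_reduced_word (w : affS n) : exists s, reduced_word w s.
Proof.
rewrite /reduced_word /len; case: ex_minnP => k /asboolP[s e <-] _; by exists s.
Qed.

Lemma cyc_dec_word_reduced (s t : seq 'I_n) : cyc_dec_word s -> reduced_word (wordprod s) t ->
  size t = size s /\ s =i t.
Proof.
move=> cs [e sz]; have sub := cyc_dec_word_sub cs e.
have us : uniq s by case: cs.
have le : (size t <= size s)%N by rewrite sz len_le_size.
have [ge et] := uniq_min_size us sub le; split=> //.
Qed.

Lemma len_cyc_dec_word (s : seq 'I_n) : cyc_dec_word s -> len (wordprod s) = size s.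
Proof.
move=> cs; have [t rt] := ex_reduced_word (wordprod s).
by have [<- _] := cyc_dec_word_reduced cs rt; case: rt.
Qed.

Lemma con_cyc_dec_word (s : seq 'I_n) : cyc_dec_word s -> con (wordprod s) =i s.
Proof.
move=> cs i; rewrite inE; apply/asboolP/idP => [[t rt it]|is_].
  by have [_ ->] := cyc_dec_word_reduced cs rt.
by exists s => //; split=> //; rewrite len_cyc_dec_word.
Qed.

(** The successor of the first letter differs from it and may not stand to its right. *)
Lemma cyc_dec_word_proper (s : seq 'I_n) : cyc_dec_word s -> exists x, x \notin s.
Proof.
case: s => [|i s]; first by exists (Ordinal (ltnW hn)).
case/cyc_dec_wordP=> _ /= /andP[/allP ps _]; exists (ordS i).
rewrite inE ordS_neq //; apply/negP=> /ps.
by rewrite /not_succ eqxx.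
Qed.

End CyclicallyDecreasing.

(** * Braid relations between runs *)

Section Factorizations.
Local Open Scope ring_scope.
Variables (n : nat) (hn : (1 < n)%N).
Local Notation residue := (residue hn).
Local Notation act_word := (act_word hn).
Local Notation zset := (zset hn).

Fixpoint run (z : int) (t : nat) : seq 'I_n :=
  if t is t'.+1 then residue z :: run (z - 1) t' else [::].

Lemma run_rcons z t : run z t.+1 = run z t ++ [:: residue (z - t%:Z)].
Proof.
elim: t z => [|t IH] z; first by rewrite /= subr0.
rewrite [LHS]/= -/(run (z - 1) t.+1) IH /=; congr (_ :: (_ ++ [:: residue _])); lia.
Qed.

Lemma size_run z t : size (run z t) = t.
Proof. by elim: t z => //= t IH z; rewrite IH. Qed.

Lemma mem_run z t i : reflect (exists2 k, (k < t)%N & i = residue (z - k%:Z)) (i \in run z t).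
Proof.
apply: (iffP idP).
  elim: t z => //= t IH z; rewrite inE => /orP[/eqP->|/IH[k kt ->]].
    by exists 0; rewrite // subr0.
  by exists k.+1 => //; congr residue; lia.
case=> k kt ->; elim: t z k kt => // t IH z [|k] kt /=.
  by rewrite subr0 mem_head.
by rewrite inE; apply/orP; right; rewrite (_ : z - k.+1%:Z = z - 1 - k%:Z) ?IH //; lia.
Qed.

Lemma in_run z t k : (k < t)%N -> residue (z - k%:Z) \in run z t.
Proof. by move=> kt; apply/mem_run; exists k. Qed.

Lemma cyc_dec_run z t : (t < n)%N -> cyc_dec_word (run z t).
Proof.
move=> tn; apply/(cyc_dec_wordP hn); elim: t z tn => //= t IH z tn.
have [|us ps] := IH (z - 1); first by lia.
rewrite us ps !andbT; split.
  apply/mem_run=> -[k kt] /eqP; rewrite eq_sym; apply/negP/residue_neq; lia.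
apply/allP=> j /mem_run[k kt ->]; rewrite /not_succ -residueS.
by apply/residue_neq; lia.
Qed.

Lemma gen_comm_run z y t : z - y + t%:Z <= n%:Z - 1 -> 1 < z - y ->
  (gen (residue z) * wordprod (run y t) = wordprod (run y t) * gen (residue z))%g.
Proof.
move=> h1 h2; apply: gen_comm_word => j /mem_run[k kt ->].
rewrite -!residueS; apply/andP; split.
  by apply/residue_neq; lia.
by rewrite eq_sym; apply/residue_neq; lia.
Qed.

(** The second letter [z] moves left past the letters up to [z - 2] and meets [z, z - 1]. The braid
    relation turns this into [z - 1, z, z - 1], the induction hypothesis applies to the runs from
    [z - 1], and [z] moves back. The bound on [t] keeps the bottom of the runs from being adjacent
    to [z] around the circle. *)
Lemma run_exchange z t : (t.+1 < n)%N ->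
  (wordprod (run z t.+1) * wordprod (run z t)
   = wordprod (run (z - 1) t) * wordprod (run z t.+1))%g.
Proof.
elim: t z => [|t IH] z tn.
  by rewrite [run z 0]/= [run (z - 1) 0]/= wordprod_nil mulg1 mul1g.
have Ez : residue z = ordS (residue (z - 1)) by rewrite -residueS subrK.
have E2 : z - 1 - 1 = z - 2 by lia.
have br := gen_braid (residue (z - 1)) (_ : (2 < n)%N).
have c := @gen_comm_run z (z - 2) t.
rewrite [run z t.+2]/= [run z t.+1]/= [run (z - 1) t.+1]/= !wordprod_cons.
rewrite E2.
transitivity (gen (residue z) * gen (residue (z - 1)) *
   (wordprod (run (z - 2) t) * gen (residue z)) * wordprod (run (z - 1) t))%g.
  by rewrite !mulgA.
rewrite -c; [|lia..].
transitivity (gen (residue z) * gen (residue (z - 1)) * gen (residue z) *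
   (wordprod (run (z - 2) t) * wordprod (run (z - 1) t)))%g.
  by rewrite !mulgA.
rewrite Ez -br -?Ez; last by lia.
transitivity (gen (residue (z - 1)) * gen (residue z) *
   (wordprod (run (z - 1) t.+1) * wordprod (run (z - 1) t)))%g.
  by rewrite [run (z - 1) t.+1]/= wordprod_cons E2 !mulgA.
rewrite IH ?E2; last by lia.
transitivity (gen (residue (z - 1)) * (gen (residue z) *
   wordprod (run (z - 2) t)) * wordprod (run (z - 1) t.+1))%g.
  by rewrite !mulgA.
rewrite c; [|lia..].
by rewrite [run (z - 1) t.+1]/= wordprod_cons E2 !mulgA.
Qed.

(** Apart from its last letter, the second run is exchanged with the first. Both then end in the
    same generator, which cancels, so two letters are lost. *)
Lemma run_square z t : (t.+1 < n)%N ->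
  (wordprod (run z t.+1) * wordprod (run z t.+1)
   = wordprod (run (z - 1) t) * wordprod (run z t))%g.
Proof.
move=> tn; rewrite {2}run_rcons [wordprod (_ ++ _)]wordprod_cat mulgA run_exchange //.
by rewrite run_rcons wordprod_cat !wordprod_cons !wordprod_nil !mulg1 -!mulgA genK mulg1.
Qed.

(** The case [k = t] concerns the letter just below the run, which would stand to the left of its
    successor. In the mirror statement below it is the letter just above the run that must be
    avoided. *)
Lemma cyc_dec_cat_run p z t : (t < n)%N -> cyc_dec_word p ->
  (forall k, (k <= t)%N -> residue (z - k%:Z) \notin p) -> cyc_dec_word (p ++ run z t).
Proof.
move=> tn /(cyc_dec_wordP hn)[up pp] h; apply/(cyc_dec_wordP hn).
have /(cyc_dec_wordP hn)[ur pr] := cyc_dec_run z tn.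
rewrite cat_uniq pairwise_cat up pp ur pr !andbT /=; split.
  by apply/hasPn=> j /mem_run[k kt ->]; apply: h; lia.
apply/allrelP=> a b ap /mem_run[k kt ->]; apply/eqP.
move/(congr1 (@ord_pred n)); rewrite ordSK -residueB => e.
by have := h k.+1 kt; rewrite (_ : z - k.+1%:Z = z - k%:Z - 1) ?e ?ap //; lia.
Qed.

Lemma cyc_dec_run_cat p z t : (t < n)%N -> cyc_dec_word p ->
  (forall k, (k <= t)%N -> residue (z + 1 - k%:Z) \notin p) -> cyc_dec_word (run z t ++ p).
Proof.
move=> tn /(cyc_dec_wordP hn)[up pp] h; apply/(cyc_dec_wordP hn).
have /(cyc_dec_wordP hn)[ur pr] := cyc_dec_run z tn.
rewrite cat_uniq pairwise_cat up pp ur pr !andbT /=; split.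
  apply/hasPn=> j jp; apply/negP=> /mem_run[k kt e].
  by have := h k.+1 kt; rewrite (_ : z + 1 - k.+1%:Z = z - k%:Z) -?e ?jp //; lia.
apply/allrelP=> a b /mem_run[k kt ->] bp; apply/eqP=> e.
by have := h k (ltnW kt); rewrite addrAC residueS -e bp.
Qed.

Lemma cyc_decP (u : affS n) : cyc_dec u -> exists s,
  [/\ cyc_dec_word s, u = wordprod s, con u =i s & len u = size s].
Proof.
case=> s cs ->; exists s; split=> //; first exact: con_cyc_dec_word.
exact: (len_cyc_dec_word hn).
Qed.

Lemma cyc_dec_inj (u v : affS n) : cyc_dec u -> cyc_dec v -> con u = con v -> u = v.
Proof.
case/cyc_decP=> s [cs -> es _] /cyc_decP[t [ct -> et _]] e.
by apply: (cyc_dec_word_eq hn) => // i; rewrite -es e et.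
Qed.

Lemma len_con (u : affS n) : cyc_dec u -> len u = #|con u|.
Proof.
case/cyc_decP=> s [cs _ es ->]; rewrite (eq_card es).
by apply/esym/card_uniqP; case: cs.
Qed.

Lemma cyc_dec_of_con (u : affS n) : cyc_dec u -> cyc_dec_of (con u) = u.
Proof.
move=> cu; apply: xget_unique => // v [cv e]; exact: cyc_dec_inj.
Qed.

(** The content misses some letter, so no run inside it goes around the circle. *)
Lemma run_lt_n (u : affS n) b t : cyc_dec u ->
  (forall k, (k <= t)%N -> zset (con u) (b - k%:Z)) -> (t.+1 < n)%N.
Proof.
case/cyc_decP=> s [cs _ es _] h; have [x xs] := cyc_dec_word_proper hn cs.
have [y ey hy] := residue_surj_below hn x b.
rewrite ltnNge; apply/negP=> tn; have := h `|b - y|%N.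
rewrite /zset (_ : b - _ = y); last by lia.
by rewrite ey es (negbTE xs) => /(_ _)/notF; apply; lia.
Qed.

Definition reducible_at (U V : int -> bool) (b : int) (t : nat) :=
  [/\ forall k, (k <= t)%N -> U (b - k%:Z) && V (b - k%:Z),
      ~~ U (b - t.+1%:Z) & ~~ V (b + 1)].

Definition off_run (s : seq 'I_n) z t := [seq i <- s | i \notin run z t].

Lemma cyc_dec_off_run s z t : cyc_dec_word s -> cyc_dec_word (off_run s z t).
Proof. by apply: (cyc_dec_word_subseq hn); apply: filter_subseq. Qed.

Lemma mem_off_run s z t i : (i \in off_run s z t) = (i \notin run z t) && (i \in s).
Proof. by rewrite mem_filter. Qed.

Lemma off_runN s z t k : (k < t)%N -> residue (z - k%:Z) \notin off_run s z t.
Proof. by move=> kt; rewrite mem_off_run in_run. Qed.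

Lemma off_run_cover s z t : (forall k, (k < t)%N -> residue (z - k%:Z) \in s) ->
  forall i, (i \in off_run s z t) || (i \in run z t) = (i \in s).
Proof.
move=> h i; rewrite mem_off_run; case: mem_run => [[k kt ->]|_]; last by rewrite orbF.
by rewrite h.
Qed.

(** The common run can be pulled to the right end of [u], as [U] avoids the letter below it, and to
    the left end of [v], as [V] avoids the letter above it. There the two copies form a square, and
    [run_square] gives a word for [w] shorter by two letters. *)
Lemma factorization_reduced (w : affS n) p b t : factorizations w p ->
  ~ reducible_at (zset (con p.1)) (zset (con p.2)) b t.
Proof.
case: p => u v [/= ew cu cv el] [hb hU hV].
have tn : (t.+1 < n)%N.
  by apply: (run_lt_n (b := b) cu) => k /hb /andP[].
have [s [cs eu cons_ ls]] := cyc_decP cu.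
have [s' [cs' ev cons' ls']] := cyc_decP cv.
rewrite /zset in hb hU hV.
have eu' : u = wordprod (off_run s b t.+1 ++ run b t.+1).
  rewrite eu; apply: (cyc_dec_word_eq hn) => //.
    apply: cyc_dec_cat_run => //; first exact: cyc_dec_off_run.
    move=> k; rewrite leq_eqVlt => /orP[/eqP->|]; last exact: off_runN.
    by rewrite mem_off_run -cons_ (negbTE hU) andbF.
  move=> i; rewrite mem_cat off_run_cover // => k kt.
  by rewrite -cons_; case/andP: (hb k kt).
have ev' : v = wordprod (run b t.+1 ++ off_run s' b t.+1).
  rewrite ev; apply: (cyc_dec_word_eq hn) => //.
    apply: cyc_dec_run_cat => //; first exact: cyc_dec_off_run.
    case=> [_|k kt]; first by rewrite subr0 mem_off_run -cons' (negbTE hV) andbF.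
    by rewrite (_ : b + 1 - _ = b - k%:Z) ?off_runN //; lia.
  move=> i; rewrite mem_cat orbC off_run_cover // => k kt.
  by rewrite -cons'; case/andP: (hb k kt).
have sz : (size (off_run s b t.+1) + t.+1 = size s)%N.
  transitivity (size (off_run s b t.+1 ++ run b t.+1)); first by rewrite size_cat size_run.
  rewrite -ls eu' len_cyc_dec_word //.
  apply: cyc_dec_cat_run => //; first exact: cyc_dec_off_run.
  move=> k; rewrite leq_eqVlt => /orP[/eqP->|]; last exact: off_runN.
  by rewrite mem_off_run -cons_ (negbTE hU) andbF.
have sz' : (size (off_run s' b t.+1) + t.+1 = size s')%N.
  transitivity (size (run b t.+1 ++ off_run s' b t.+1)).
    by rewrite size_cat size_run addnC.
  rewrite -ls' ev' len_cyc_dec_word //.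
  apply: cyc_dec_run_cat => //; first exact: cyc_dec_off_run.
  case=> [_|k kt]; first by rewrite subr0 mem_off_run -cons' (negbTE hV) andbF.
  by rewrite (_ : b + 1 - _ = b - k%:Z) ?off_runN //; lia.
have := len_le_size (off_run s b t.+1 ++ (run (b - 1) t ++ run b t) ++ off_run s' b t.+1).
rewrite wordprod_cat wordprod_cat [wordprod (run _ _ ++ _)]wordprod_cat -run_square //.
rewrite -!mulgA (mulgA (wordprod (off_run s _ _))) -(wordprod_cat (off_run s _ _)) -(wordprod_cat (run _ _)) -eu' -ev' -ew el ls ls' !size_cat !size_run.
by move: sz sz'; set A := size (off_run s _ _); set A' := size (off_run s' _ _); lia.
Qed.

(* The transformation [1 3^t -> 3^t 2] on the positions [b - t], ..., [b]. *)
Lemma exchange (p q : seq 'I_n) b t : (t.+1 < n)%N -> cyc_dec_word p -> cyc_dec_word q ->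
  (forall k, (k <= t.+1)%N -> residue (b - k%:Z) \notin p) ->
  (forall k, (k <= t.+1)%N -> residue (b + 1 - k%:Z) \notin q) ->
  [/\ cyc_dec_word (p ++ run b t.+1), cyc_dec_word (run b t ++ q),
      cyc_dec_word (p ++ run (b - 1) t), cyc_dec_word (run b t.+1 ++ q) &
      (wordprod (p ++ run b t.+1) * wordprod (run b t ++ q)
      = wordprod (p ++ run (b - 1) t) * wordprod (run b t.+1 ++ q))%g].
Proof.
move=> tn cp cq hp hq; split.
- exact: cyc_dec_cat_run.
- by apply: cyc_dec_run_cat => // [|k kt]; [lia | apply: hq; lia].
- apply: cyc_dec_cat_run => // [|k kt]; first by lia.
  by rewrite (_ : b - 1 - k%:Z = b - k.+1%:Z) ?hp //; lia.
- exact: cyc_dec_run_cat.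
- by rewrite !wordprod_cat -mulgA [X in (_ * X)%g]mulgA run_exchange // !mulgA.
Qed.

Lemma exchange_e (u v : affS n) b t : cyc_dec u -> cyc_dec v ->
  (forall k, (k <= t)%N -> zset (con u) (b - k%:Z)) -> ~~ zset (con u) (b - t.+1%:Z) ->
  (forall k, (k < t)%N -> zset (con v) (b - k%:Z)) -> ~~ zset (con v) (b - t%:Z) ->
  ~~ zset (con v) (b + 1) ->
  exists u' v', [/\ cyc_dec u', cyc_dec v', con u' = con u :\ residue b,
     con v' = residue (b - t%:Z) |: con v & (u * v = u' * v')%g].
Proof.
move=> cu cv hu hu' hv hv' hv''.
have tn := run_lt_n cu hu.
have [s [cs eu cons_ ls]] := cyc_decP cu.
have [s' [cs' ev cons' ls']] := cyc_decP cv.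
rewrite /zset in hu hu' hv hv' hv''.
have [//|||||c1 c2 c3 c4 e] := @exchange (off_run s b t.+1) (off_run s' b t.+1) b t.
- exact: cyc_dec_off_run.
- exact: cyc_dec_off_run.
- move=> k; rewrite leq_eqVlt => /orP[/eqP->|]; last exact: off_runN.
  by rewrite mem_off_run -cons_ (negbTE hu') andbF.
- case=> [_|k kt]; first by rewrite subr0 mem_off_run -cons' (negbTE hv'') andbF.
  by rewrite (_ : b + 1 - _ = b - k%:Z) ?off_runN //; lia.
have m1 : off_run s b t.+1 ++ run b t.+1 =i s.
  by move=> i; rewrite mem_cat off_run_cover // => k kt; rewrite -cons_ hu.
have m2 : run b t ++ off_run s' b t.+1 =i s'.
  move=> i; rewrite mem_cat mem_off_run run_rcons mem_cat mem_seq1 negb_or.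
  case: (mem_run b t i) => [[k kt ->]|_] /=; first by rewrite -cons' hv.
  by case: eqP => // ->; rewrite -cons' (negbTE hv').
have m3 : off_run s b t.+1 ++ run (b - 1) t =i con u :\ residue b.
  move=> i; rewrite in_setD1 mem_cat mem_off_run /= in_cons negb_or -cons_.
  case: eqP => [->|_] /=.
    apply/mem_run=> -[k kt] /eqP; rewrite eq_sym; apply/negP/residue_neq; lia.
  case: mem_run => [[k kt ->]|_] /=; last by rewrite orbF.
  by rewrite (_ : b - 1 - _ = b - k.+1%:Z) ?hu //; lia.
have m4 : run b t.+1 ++ off_run s' b t.+1 =i residue (b - t%:Z) |: con v.
  move=> i; rewrite in_setU1 mem_cat mem_off_run run_rcons mem_cat mem_seq1 negb_or cons'.
  case: (mem_run b t i) => [[k kt ->]|_] /=; first by rewrite -cons' hv ?orbT.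
  by case: eqP.
exists (wordprod (off_run s b t.+1 ++ run (b - 1) t)).
exists (wordprod (run b t.+1 ++ off_run s' b t.+1)); split.
- by exists (off_run s b t.+1 ++ run (b - 1) t).
- by exists (run b t.+1 ++ off_run s' b t.+1).
- by apply/setP=> i; rewrite (con_cyc_dec_word hn).
- by apply/setP=> i; rewrite (con_cyc_dec_word hn).
- rewrite -e eu ev; congr (_ * _)%g.
    by apply: (cyc_dec_word_eq hn) => // i; rewrite m1.
  by apply: (cyc_dec_word_eq hn) => // i; rewrite m2.
Qed.

(** The relation of [exchange], read from right to left. *)
Lemma exchange_f (u v : affS n) b t : cyc_dec u -> cyc_dec v ->
  (forall k, (k <= t)%N -> zset (con v) (b - k%:Z)) -> ~~ zset (con v) (b + 1) ->
  (forall k, (0 < k <= t)%N -> zset (con u) (b - k%:Z)) -> ~~ zset (con u) b ->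
  ~~ zset (con u) (b - t.+1%:Z) ->
  exists u' v', [/\ cyc_dec u', cyc_dec v', con u' = residue b |: con u,
     con v' = con v :\ residue (b - t%:Z) & (u * v = u' * v')%g].
Proof.
move=> cu cv hv hv' hu hu' hu''.
have tn := run_lt_n cv hv.
have [s [cs eu cons_ ls]] := cyc_decP cu.
have [s' [cs' ev cons' ls']] := cyc_decP cv.
rewrite /zset in hu hu' hu'' hv hv'.
have [//|||||c1 c2 c3 c4 e] := @exchange (off_run s b t.+1) (off_run s' b t.+1) b t.
- exact: cyc_dec_off_run.
- exact: cyc_dec_off_run.
- move=> k; rewrite leq_eqVlt => /orP[/eqP->|]; last exact: off_runN.
  by rewrite mem_off_run -cons_ (negbTE hu'') andbF.
- case=> [_|k kt]; first by rewrite subr0 mem_off_run -cons' (negbTE hv') andbF.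
  by rewrite (_ : b + 1 - _ = b - k%:Z) ?off_runN //; lia.
have m3 : off_run s b t.+1 ++ run (b - 1) t =i s.
  move=> i; rewrite mem_cat mem_off_run /= in_cons negb_or.
  case: (mem_run (b - 1) t i) => [[k kt ->]|_] /=.
    rewrite orbT (_ : b - 1 - _ = b - k.+1%:Z); last by lia.
    by rewrite -cons_ hu.
  by rewrite orbF andbT; case: eqP => // ->; rewrite -cons_ (negbTE hu').
have m4 : run b t.+1 ++ off_run s' b t.+1 =i s'.
  by move=> i; rewrite mem_cat orbC off_run_cover // => k kt; rewrite -cons' hv.
have m1 : off_run s b t.+1 ++ run b t.+1 =i residue b |: con u.
  move=> i; rewrite in_setU1 mem_cat mem_off_run /= in_cons negb_or -cons_.
  case: eqP => [->|_] /=; first by rewrite ?orbT.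
  case: mem_run => [[k kt ->]|_] /=; last by rewrite orbF.
  by rewrite (_ : b - 1 - _ = b - k.+1%:Z) ?hu //; lia.
have m2 : run b t ++ off_run s' b t.+1 =i con v :\ residue (b - t%:Z).
  move=> i; rewrite in_setD1 mem_cat mem_off_run run_rcons mem_cat mem_seq1 negb_or cons'.
  case: (mem_run b t i) => [[k kt ->]|_] /=; last by [].
  rewrite -cons' hv ?andbT //; last by lia.
  by rewrite eq_sym; apply/esym/residue_neq; lia.
exists (wordprod (off_run s b t.+1 ++ run b t.+1)).
exists (wordprod (run b t ++ off_run s' b t.+1)); split.
- by exists (off_run s b t.+1 ++ run b t.+1).
- by exists (run b t ++ off_run s' b t.+1).
- by apply/setP=> i; rewrite (con_cyc_dec_word hn).
- by apply/setP=> i; rewrite (con_cyc_dec_word hn).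
- rewrite e eu ev; congr (_ * _)%g.
    by apply: (cyc_dec_word_eq hn) => // i; rewrite m3.
  by apply: (cyc_dec_word_eq hn) => // i; rewrite m4.
Qed.

End Factorizations.

(** * Admissible letters *)

Section DecreasingMaps.
Local Open Scope ring_scope.

Definition unbounded_below (V : int -> bool) := forall z, exists2 y, y <= z & ~~ V y.

Lemma run_bottom V z : unbounded_below V -> V z ->
  exists i : int, [/\ i <= z, forall y : int, i <= y <= z -> V y & ~~ V (i - 1)].
Proof.
move=> ub Vz; have [y yz Vy] := ub z.
have [m em] : exists m : nat, z = y + m%:Z by exists `|z - y|%N; lia.
elim: m z Vz em {yz ub} => [|m IH] z Vz ez.
  by rewrite ez addr0 (negbTE Vy) in Vz.
have [V1|V1] := boolP (V (z - 1)).
  have [|i [iz h1 h2]] := IH _ V1; first by lia.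
  exists i; split=> // [|x hx]; first by lia.
  by have [->//|xz] := eqVneq x z; apply: h1; lia.
by exists z; split=> // x hx; have -> : x = z by lia.
Qed.

Variables (U V : int -> bool) (dU dV : int -> int).
Hypotheses (decU : decreasing_map U dU) (decV : decreasing_map V dV).
Hypothesis red : forall b t, ~ reducible_at U V b t.

Lemma dec_ge (W : int -> bool) d z : decreasing_map W d -> z - 1 <= d z.
Proof.
by case=> dn up; have [/dn->//|/up[h _ _]] := boolP (W (z - 1)); lia.
Qed.

Lemma dec_fix (W : int -> bool) d z :
  decreasing_map W d -> ~~ W (z - 1) -> ~~ W z -> d z = z.
Proof.
case=> _ up /up[h1 h2 _] Wz; apply/eqP; rewrite eq_le h1 andbT leNgt.
by apply/negP=> lt; rewrite h2 ?lexx in Wz.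
Qed.

Lemma dec_gt (W : int -> bool) d z y : decreasing_map W d -> ~~ W (z - 1) ->
  z <= y -> (forall x, z <= x <= y -> W x) -> y < d z.
Proof.
case=> _ up /up[h1 h2 h3] zy h; rewrite ltNge; apply/negP=> le.
by rewrite h in h3 => //; lia.
Qed.

Lemma dec_eq (W : int -> bool) d z y : decreasing_map W d -> ~~ W (z - 1) ->
  z <= y -> (forall x, z <= x < y -> W x) -> ~~ W y -> d z = y.
Proof.
case=> _ up /up[h1 h2 h3] zy h Wy; case: (ltgtP (d z) y) => // lt.
  by rewrite h ?h1 // in h3.
by rewrite h2 ?zy // in Wy.
Qed.

Lemma dec_le_bar (W : int -> bool) d z b : decreasing_map W d -> ~~ W b ->
  z <= b -> d z <= b.
Proof.
move=> [dn up] Wb zb; have [/dn->|/up[h1 h2 _]] := boolP (W (z - 1)); first by lia.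
by rewrite leNgt; apply/negP=> lt; rewrite h2 ?zb in Wb.
Qed.

Lemma dec_gt_bar (W : int -> bool) d z b : decreasing_map W d -> ~~ W b ->
  b < z -> b < d z.
Proof.
move=> [dn up] Wb zb; have [Wz|/up[h1 h2 _]] := boolP (W (z - 1)); last by lia.
rewrite dn //; have : z - 1 != b by apply/eqP=> e; rewrite -e Wz in Wb.
by lia.
Qed.

(** A word of the product that avoided [z0] would preserve the half line up to [z0], so this forces
    [z0] into every such word. The crossing point is [z0 + 1] or [z0 + 2]. The only obstruction is
    that [dU] takes back the crossing made by [dV] while [z0 + 1] avoids [V]; this is the forbidden
    pattern with a single common letter. *)
Lemma factorization_crosses z0 : U z0 || V z0 -> exists2 z, z0 < z & dU (dV z) <= z0.
Proof.
have [dnU upU] := decU; have [dnV upV] := decV.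
have [Vz _|Vz] := boolP (V z0).
  have e1 : dV (z0 + 1) = z0 by rewrite dnV addrK.
  have [le|lt] := lerP (dU z0) z0; first by exists (z0 + 1); rewrite ?e1 //; lia.
  have U1 : ~~ U (z0 - 1) by apply/negP=> /dnU; lia.
  have Uz : U z0 by have [_ h _] := upU _ U1; apply: h; rewrite lexx.
  have [V1|V1] := boolP (V (z0 + 1)); last first.
    case: (@red z0 0); split; rewrite ?subr0 // => k.
    by rewrite leqn0 => /eqP->; rewrite subr0 Uz Vz.
  exists (z0 + 2); first by lia.
  rewrite dnV (_ : z0 + 2 - 1 = z0 + 1) //; try lia.
  by rewrite dnU addrK.
rewrite orbF => Uz; have [V1|V1] := boolP (V (z0 + 1)).
  exists (z0 + 2); first by lia.
  rewrite dnV (_ : z0 + 2 - 1 = z0 + 1) //; try lia.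
  by rewrite dnU addrK.
exists (z0 + 1); first by lia.
by rewrite (dec_fix decV) ?addrK // dnU addrK.
Qed.

(** This is [admissible] on the integers, for [W = U] and [X = V]: [i = b - t + 1] is the lowest
    letter of the run in [V]. *)
Definition pivotal (W X : int -> bool) (b : int) := exists i : int,
  [/\ i <= b, forall y : int, i <= y <= b -> X y, forall y : int, i <= y <= b -> W (y - 1),
      ~~ W b & ~~ X (i - 1)].

(* A description of the pivotal positions in terms of the product map alone. *)
Definition pivotal_map (w : int -> int) (b : int) := exists i : int,
  [/\ i <= b, b < w i, forall j : int, i < j <= b + 1 -> w j = j - 2 &
      forall j : int, j <= b -> b < w j -> j = i].

(** As [b] is outside [U], [dU] preserves the half line up to [b], so the points crossing [b]
    upwards are those that [dV] moves across it. Such a point is the bottom of a run of [V]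
    containing [b], hence it is [i]. *)
Lemma pivotal_pivotal_map b : pivotal U V b -> pivotal_map (dU \o dV) b.
Proof.
have [dnU upU] := decU; have [dnV upV] := decV.
case=> i [ib hV hU nU nV]; exists i; split=> //=.
- by apply: (dec_gt_bar decU) => //; apply: (dec_gt decV).
- move=> j hj; rewrite dnV; last by apply: hV; lia.
  by rewrite dnU; [lia | apply: hU; lia].
- move=> j jb lt.
  have ltV : b < dV j.
    by rewrite ltNge; apply/negP=> /(dec_le_bar decU nU); lia.
  have Vj : ~~ V (j - 1) by apply/negP=> /dnV; lia.
  have [_ h _] := upV _ Vj.
  case: (ltgtP j i) => // ji; last by case/negP: Vj; apply: hV; lia.
  by case/negP: nV; apply: h; lia.
Qed.

Hypotheses (ubU : unbounded_below U) (ubV : unbounded_below V).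

(** The runs are read off from the points that fall by two. What needs reducedness is [b] being
    outside [U]: otherwise a point other than [i] crosses [b], or [i] itself does not, or the
    forbidden pattern occurs. *)
Lemma pivotal_map_pivotal b : pivotal_map (dU \o dV) b -> pivotal U V b.
Proof.
have [dnU upU] := decU; have [dnV upV] := decV.
case=> i [/= ib wi wj uniq].
(* Each factor lowers a point by at most one, so a fall by two makes both of them descend. *)
have hVU (j : int) : i < j <= b + 1 -> V (j - 1) /\ U (j - 2).
  move=> /wj e; have [V1|V1] := boolP (V (j - 1)); last first.
    by exfalso; have := dec_ge (dV j) decU; have [h _ _] := upV _ V1; lia.
  split=> //; move: e; rewrite dnV // => e.
  have [|U1] := boolP (U (j - 1 - 1)); first by rewrite (_ : j - 1 - 1 = j - 2) //; lia.
  by exfalso; have [h _ _] := upU _ U1; lia.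
have hV (y : int) : i <= y <= b -> V y.
  by move=> h; have [|] := hVU (y + 1); rewrite ?addrK //; lia.
have hU (y : int) : i <= y <= b -> U (y - 1).
  move=> h; have [|_] := hVU (y + 1); first by lia.
  by rewrite (_ : y + 1 - 2 = y - 1) //; lia.
have nU : ~~ U b.
  apply/negP=> Ub.
  have hU' (y : int) : i - 1 <= y <= b -> U y.
    move=> h; have [->//|yb] := eqVneq y b.
    by rewrite (_ : y = y + 1 - 1) ?hU //; lia.
  have [V1|V1] := boolP (V (i - 1)).
    have e : dV i = i - 1 by rewrite dnV.
    have nU2 : ~~ U (i - 1 - 1) by apply/negP=> /dnU; move: wi; rewrite e; lia.
    (* The bottom [i0] of the run of [V] through [i - 1] goes above [b] under [dV]. Being different
       from [i], it is brought back by [dU], necessarily from [b + 1]; so [b + 1] is outside [V] and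
       the pattern occurs on [i - 1, ..., b]. *)
    have [i0 [i0i h0 nV0]] := run_bottom ubV V1.
    have h0' (y : int) : i0 <= y <= b -> V y.
      by move=> h; case: (lerP y (i - 1)) => h'; [apply: h0 | apply: hV]; lia.
    have gt : b < dV i0 by apply: (dec_gt decV) => //; lia.
    have le : dU (dV i0) <= b.
      by rewrite leNgt; apply/negP=> /uniq; lia.
    have eN : dV i0 = b + 1 by have := dec_ge (dV i0) decU; lia.
    have nVb : ~~ V (b + 1) by rewrite -eN; have [] := upV _ nV0.
    case: (@red b (absz (b - (i - 1))%R)); split=> //.
    - by move=> k kb; rewrite hU' ?h0' //; lia.
    - by rewrite (_ : b - _ = i - 1 - 1) //; lia.
  have [Vb|Vb] := boolP (V (b + 1)); last first.
    have e : dV i = b + 1 by apply: (dec_eq decV) => // [|x hx]; [lia | apply: hV; lia].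
    by move: wi; rewrite e dnU ?addrK // ltxx.
  have U1 : U (i - 1) by apply: hU'; lia.
  (* The bottom [su] of the run of [U] goes above [b] under [dU]. Its preimage under [dV] is
     [su + 1], [su] or the bottom of the run of [V] ending at [su - 1]; in each case this is a
     second crossing point besides [i]. *)
  have [su [sui hsu nsu]] := run_bottom ubU U1.
  have gt : b < dU su.
    apply: (dec_gt decU) => // [|x hx]; first by lia.
    by case: (lerP x (i - 1)) => h'; [apply: hsu | apply: hU']; lia.
  have [Vsu|Vsu] := boolP (V su).
    have := uniq (su + 1); rewrite dnV addrK // => /(_ _ gt) e.
    have e' : su = i - 1 by have := e _; lia.
    by rewrite e' (negbTE V1) in Vsu.
  have [V2|V2] := boolP (V (su - 1)); last first.
    by have := uniq su; rewrite (dec_fix decV) // => /(_ _ gt); lia.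
  have [j [jsu hj nj]] := run_bottom ubV V2.
  have e : dV j = su by apply: (dec_eq decV) => // [|x hx]; [lia | apply: hj; lia].
  by have := uniq j; rewrite e => /(_ _ gt); lia.
exists i; split=> //; apply/negP=> V1.
by move: wi; rewrite dnV // ltNge (dec_le_bar decU) //; lia.
Qed.

End DecreasingMaps.

(** * Contents and admissible letters as invariants of the product *)

Section Content.
Local Open Scope ring_scope.
Variables (n : nat) (hn : (1 < n)%N).
Local Notation residue := (residue hn).
Local Notation act_word := (act_word hn).
Local Notation zset := (zset hn).

Definition act (w : affS n) := act_word (affS_repr w).

Lemma act_wordE (s : seq (ordinal n)) z : act (wordprod s) z = act_word s z.
Proof. by apply: act_wordprod; rewrite -affS_class_wordprod affS_reprK. Qed.

Lemma act_mul (u v : affS n) z : act (u * v)%g z = act u (act v z).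
Proof.
have E (w : affS n) : w = wordprod (affS_repr w) by rewrite -affS_class_wordprod affS_reprK.
by rewrite {1}(E u) {1}(E v) -wordprod_cat act_wordE act_word_cat.
Qed.

Lemma act_cyc_dec (u : affS n) : cyc_dec u -> decreasing_map (zset (con u)) (act u).
Proof.
case/(cyc_decP hn)=> s [cs eu es _].
have -> : zset (con u) = fun z => residue z \in s by apply/funext=> z; rewrite /zset es.
have -> : act u = act_word s by apply/funext=> z; rewrite eu act_wordE.
exact: act_cyc_dec_word.
Qed.

Lemma zset_con_unbounded (u : affS n) : cyc_dec u -> unbounded_below (zset (con u)).
Proof.
case/(cyc_decP hn)=> s [cs _ es _] z; have [x xs] := cyc_dec_word_proper hn cs.
have [y ey hy] := residue_surj_below hn x z; exists y; first by lia.
by rewrite /zset es ey.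
Qed.

(** A letter of either content makes the product move a point down across it, so no word of the
    product avoids that letter. Conversely the reduced words of the factors can be concatenated. *)
Lemma in_parabolic_con (w : affS n) p x : factorizations w p ->
  in_parabolic x w <-> x \notin con p.1 :|: con p.2.
Proof.
move=> fp; have red b t := @factorization_reduced n hn w p b t fp; case: p fp red => u v [/= ew cu cv _] red.
split.
  case=> s es xs; rewrite finset.in_setU; apply/negP=> h.
  have := factorization_crosses (act_cyc_dec cu) (act_cyc_dec cv) red.
  move=> /(_ x%:Z); rewrite /zset residue_nat => /(_ h)[z zx].
  rewrite -act_mul -ew -es act_wordE act_word_le; first by lia.
  by rewrite residue_nat.
have [s [cs eu es _]] := cyc_decP hn cu; have [t [ct ev et _]] := cyc_decP hn cv.
rewrite finset.in_setU es et -mem_cat => h; exists (s ++ t) => //.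
by rewrite wordprod_cat ew eu ev.
Qed.

Lemma admissibleP (U V : {set 'I_n}) b :
  admissible U V (residue b) <-> pivotal (zset U) (zset V) b.
Proof.
split=> [[t [t1 hU hV nU nV]]|[i [ib hV hU nU nV]]].
  exists (b - t%:Z + 1); split=> //; first by lia.
  - move=> y hy; have := hV `|b - y|%N; rewrite -residue_subn => h.
    by rewrite /zset (_ : y = b - `|b - y|%N%:Z); [apply: h|]; lia.
  - move=> y hy; have := hU (absz (b - (y - 1))%R); rewrite -residue_subn => h.
    by rewrite /zset (_ : y - 1 = b - (absz (b - (y - 1))%R)%:Z); [apply: h|]; lia.
  - by rewrite addrK /zset residue_subn.
exists (absz (b - (i - 1))%R); split=> //; first by lia.
- move=> k hk; rewrite -residue_subn.
  by have := hU (b - k%:Z + 1); rewrite addrK; apply; lia.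
- by move=> k hk; rewrite -residue_subn; apply: hV; lia.
- rewrite -residue_subn.
  have -> : b - (absz (b - (i - 1))%R)%:Z = i - 1 by lia.
  exact: nV.
Qed.

Lemma admissible_invariant (w : affS n) p p' x : factorizations w p -> factorizations w p' ->
  admissible (con p.1) (con p.2) x -> admissible (con p'.1) (con p'.2) x.
Proof.
rewrite -(residue_nat hn x) => fp fp' /admissibleP h; apply/admissibleP.
have red' b t := @factorization_reduced n hn w p' b t fp'.
case: p p' fp fp' h red' => u v [u' v'] [/= e cu cv _] [/= e' cu' cv' _] h red'.
apply: (pivotal_map_pivotal (act_cyc_dec cu') (act_cyc_dec cv') red').
- exact: zset_con_unbounded.
- exact: zset_con_unbounded.
have -> : act u' \o act v' = act u \o act v.
  by apply/funext=> z /=; rewrite -!act_mul -e -e'.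
by have := pivotal_pivotal_map (act_cyc_dec cu) (act_cyc_dec cv) h.
Qed.

(** Outside the parabolic case every position lies in [U] or [V]. Take [z] outside [U] and the run
    of [V] containing it, with bottom [i]; then [i - 1] lies in [U], and [b] is the first position
    from [i] on outside [U]. *)
Lemma ex_admissible (w : affS n) p : factorizations w p -> ~ some_parabolic w ->
  exists x, admissible (con p.1) (con p.2) x.
Proof.
move=> fp np.
have full z : zset (con p.1) z || zset (con p.2) z.
  rewrite -finset.in_setU; apply/negPn/negP=> h; apply: np; exists (residue z).
  exact/(in_parabolic_con _ fp).
case: fp => _ cu cv _; have [z _ Uz] := zset_con_unbounded cu 0.
have Vz : zset (con p.2) z by have := full z; rewrite (negbTE Uz).
have [i [iz hi ni]] := run_bottom (zset_con_unbounded cv) Vz.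
have Ui : zset (con p.1) (i - 1) by have := full (i - 1); rewrite (negbTE ni) orbF.
suff [b [hb Ub h]] : exists b, [/\ i <= b <= z, ~~ zset (con p.1) b &
    forall y : int, i <= y < b -> zset (con p.1) y].
  exists (residue b); apply/admissibleP; exists i; split=> //; first by lia.
  - by move=> y hy; apply: hi; lia.
  - move=> y hy; have [->//|yi] := eqVneq y i.
    by apply: h; lia.
have [m em] : exists m : nat, z = i + m%:Z by exists `|z - i|%N; lia.
elim/ltn_ind: m z Uz em {Vz iz hi} => m IH z Uz em.
case: (pselect (exists y, i <= y < z /\ ~~ zset (con p.1) y)) => [[y [hy Uy]]|no].
  have [||b [hb Ub h]] := IH `|y - i|%N _ y Uy; [lia|lia|].
  by exists b; split=> //; lia.
exists z; split=> //; first by lia.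
by move=> y hy; apply/negPn/negP=> Uy; apply: no; exists y.
Qed.

End Content.

(** * The pairing as a bracketing *)

Section Heights.
Local Open Scope ring_scope.

(* Read the letters [1], ..., [k] in increasing order, [g] as a closing and then [f] as an opening
   bracket; [height f g k] is the height of the path just before the opening bracket at [k]. *)
Fixpoint height (f g : nat -> bool) (k : nat) : int :=
  if k is k'.+1 then height f g k' + (f k' : nat)%:Z - (g k : nat)%:Z else 0.

Lemma eq_height f g f' g' k : (forall i, (i < k)%N -> f i = f' i) ->
  (forall i, (0 < i <= k)%N -> g i = g' i) -> height f g k = height f' g' k.
Proof.
elim: k => //= k IH hf hg; rewrite hf // hg ?ltnS ?leqnn // IH // => i hi.
  by apply: hf; lia.
by apply: hg; lia.
Qed.

Lemma height_drop (f f' g : nat -> bool) p k : f p -> ~~ f' p ->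
  (forall i, (i < k)%N -> i != p -> f' i = f i) ->
  height f' g k = height f g k - (p < k)%N%:Z.
Proof.
move=> fp f'p; elim: k => //= k IH h; rewrite IH; last by move=> i ik; apply: h; lia.
have [->|kp] := eqVneq k p; first by rewrite fp (negbTE f'p); lia.
by rewrite h //; lia.
Qed.

Lemma height_drop_closing (f g g' : nat -> bool) q k : g q -> ~~ g' q -> (0 < q)%N ->
  (forall i, (i <= k)%N -> i != q -> g' i = g i) ->
  height f g' k = height f g k + (q <= k)%N%:Z.
Proof.
move=> gq g'q q0; elim: k => /= [|k IH] h; first by lia.
rewrite IH; last by move=> i ik; apply: h; lia.
have [e|kq] := eqVneq k.+1 q; first by rewrite e gq (negbTE g'q); lia.
by rewrite h //; lia.
Qed.

Lemma height_gap (f g : nat -> bool) p k : f p -> (p < k)%N -> (forall i, (p < i < k)%N -> ~~ f i && ~~ g i) ->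
  height f g k = height f g p + 1 - (g k : nat)%:Z.
Proof.
move=> fp; elim: k => // k IH pk h /=.
have [->|kp] := eqVneq k p; first by rewrite fp; lia.
rewrite IH; [|lia|by move=> i hi; apply: h; lia].
have /andP[/negbTE-> /negbTE->] : ~~ f k && ~~ g k by apply: h; lia.
by lia.
Qed.

Lemma height_decr (f g : nat -> bool) j k : (forall i, ~~ f i) -> (j <= k)%N -> height f g k <= height f g j.
Proof.
move=> hf; elim: k => [|k IH]; first by rewrite leqn0 => /eqP->.
rewrite leq_eqVlt => /orP[/eqP->//|jk] /=.
by rewrite (negbTE (hf k)); have := IH jk; lia.
Qed.

Lemma ex_last_argmin (h : nat -> int) N : exists2 b, (b <= N)%N &
  (forall k, (k <= N)%N -> h b <= h k) /\ (forall k, (b < k <= N)%N -> h b < h k).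
Proof.
elim: N => [|N [b bN [h1 h2]]].
  by exists 0 => //; split=> k hk; [have -> : k = 0 by lia | lia].
case: (lerP (h N.+1) (h b)) => le; [exists N.+1 => // | exists b; first by lia].
  split=> k hk; last by lia.
  have [->//|kN] := eqVneq k N.+1; have := h1 k; lia.
split=> k hk; have [->|kN] := eqVneq k N.+1; try lia.
  by apply: h1; lia.
by apply: h2; lia.
Qed.

Lemma ex_first_argmin (h : nat -> int) N : exists2 a, (a <= N)%N &
  (forall k, (k <= N)%N -> h a <= h k) /\ (forall k, (k < a)%N -> h a < h k).
Proof.
elim: N => [|N [a aN [h1 h2]]].
  by exists 0 => //; split=> k hk; [have -> : k = 0 by lia | lia].
case: (ltrP (h N.+1) (h a)) => le; [exists N.+1 => // | exists a; first by lia].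
  split=> k hk; last by have := h1 k; lia.
  have [->//|kN] := eqVneq k N.+1; have := h1 k; lia.
split=> k hk; last by apply: h2; lia.
by have [->//|kN] := eqVneq k N.+1; apply: h1; lia.
Qed.

Section RemoveBrackets.
Variables (H H' : nat -> int) (N p c : nat).

Section Matched.
Variable q : nat.
Hypotheses (pq : (p < q <= N)%N)
  (H'E : forall k, (k <= N)%N -> H' k = H k - (p < k)%N%:Z + (q <= k)%N%:Z)
  (gap : forall k, (p < k < q)%N -> H k = H p + 1).

(** Between the two removed brackets the height falls to [H p], so the inequality at [p] already
    covers these positions. *)
Lemma matched_left : (c < p)%N ->
  (forall k, (c < k <= N)%N -> H c < H k) <-> (forall k, (c < k <= N)%N -> H' c < H' k).
Proof.
move=> cp; split=> h k hk.
  have := h k hk; have := h p; have := @gap k; rewrite !H'E; lia.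
by have := h k hk; rewrite !H'E; lia.
Qed.

Lemma matched_right : H q = H p -> (c <= N)%N -> c != q -> ~~ (p < c < q)%N ->
  (forall k, (k < c)%N -> H c < H k) <-> (forall k, (k < c)%N -> H' c < H' k).
Proof.
move=> Hq cN cq npcq; split=> h k hk.
  have := h k hk; have := h p; have := @gap k; rewrite !H'E; lia.
by have := h k hk; rewrite !H'E; lia.
Qed.
End Matched.

Hypotheses (pN : (p <= N)%N) (H'E : forall k, (k <= N)%N -> H' k = H k - (p < k)%N%:Z).

Lemma unmatched_left : (forall k, (p < k <= N)%N -> H k = H p + 1) -> (c < p)%N ->
  (forall k, (c < k <= N)%N -> H c < H k) <-> (forall k, (c < k <= N)%N -> H' c < H' k).
Proof.
move=> gap cp; split=> h k hk.
  have := h k hk; have := h p; have := gap k; rewrite !H'E; lia.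
by have := h k hk; rewrite !H'E; lia.
Qed.

Lemma unmatched_right : (c <= p)%N ->
  (forall k, (k < c)%N -> H c < H k) <-> (forall k, (k < c)%N -> H' c < H' k).
Proof. by move=> cp; split=> h k hk; have := h k hk; rewrite !H'E; lia. Qed.

End RemoveBrackets.

End Heights.

(** * The greedy pairing as bracket matching *)

Section Pairing.
Local Open Scope ring_scope.
Variables (n : nat) (hn : (1 < n)%N) (x : 'I_n).

Definition letter (k : nat) : 'I_n := iter k (@ordS n) x.

(** The letter [x] is missing from [asc x], so its index is [n - 1] and [pos x = n]. Thus [pos]
    inverts [letter] on the positions 1, ..., n. *)
Definition pos (a : 'I_n) : nat := (rank x a).+1.

Lemma letterE k : letter k = residue hn (x%:Z + k%:Z).
Proof. by rewrite residue_addn residue_nat. Qed.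

Lemma letterS k : letter k.+1 = ordS (letter k). Proof. by []. Qed.

Lemma letter_inj j k : letter j = letter k -> (j <= k + n.-1)%N -> (k <= j + n.-1)%N -> j = k.
Proof.
by rewrite !letterE => e h1 h2; have := residue_inj_small e; lia.
Qed.

Lemma letter_n : letter n = x.
Proof. by rewrite letterE residue_period residue_nat. Qed.

Lemma ascE : asc x = [seq letter k | k <- iota 1 n.-1].
Proof.
apply: (@eq_from_nth _ (ordS x)); first by rewrite size_traject size_map size_iota.
move=> i; rewrite size_traject => hi.
by rewrite /asc nth_traject // (nth_map 0) ?size_iota // nth_iota // add1n /letter iterSr.
Qed.

Lemma asc_uniq : uniq (asc x).
Proof.
rewrite ascE map_inj_in_uniq ?iota_uniq // => i j; rewrite !mem_iota => hi hj e.
by apply: letter_inj => //; lia.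
Qed.

Lemma pos_letter k : (0 < k <= n)%N -> pos (letter k) = k.
Proof.
move=> hk; rewrite /pos /rank; have [kn|kn] := eqVneq k n.
  rewrite memNindex ?size_traject; first by lia.
  rewrite kn ascE; apply/mapP=> -[i]; rewrite mem_iota => hi /letter_inj; lia.
rewrite ascE (_ : letter k = nth x [seq letter k | k <- iota 1 n.-1] k.-1).
  by rewrite index_uniq ?size_map ?size_iota -?ascE ?asc_uniq //; lia.
rewrite (nth_map 0) ?size_iota; last by lia.
by rewrite nth_iota; [congr letter|]; lia.
Qed.

Lemma ex_pos a : exists2 k, (0 < k <= n)%N & letter k = a.
Proof.
have [y ey hy] := residue_surj_above hn a (x%:Z + 1).
exists `|y - x%:Z|%N; first by lia.
by rewrite letterE -ey; congr residue; lia.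
Qed.

Lemma posP a : (0 < pos a <= n)%N /\ letter (pos a) = a.
Proof. by have [k hk <-] := ex_pos a; rewrite pos_letter. Qed.

Lemma pos_range a : (0 < pos a <= n)%N. Proof. by have [] := posP a. Qed.

Lemma letter_pos a : letter (pos a) = a. Proof. by have [] := posP a. Qed.

Lemma pos_inj : injective pos. Proof. exact: can_inj letter_pos. Qed.

Lemma pos_x : pos x = n.
Proof. by rewrite -{1}letter_n pos_letter; lia. Qed.

Lemma pos_lt a : (pos a < n)%N = (a != x).
Proof.
have := pos_range a; have [->|ax] := eqVneq a x; first by rewrite pos_x; lia.
have : pos a != n by apply: contra_neq ax => e; apply: pos_inj; rewrite pos_x.
by lia.
Qed.

Lemma mem_asc a : (a \in asc x) = (a != x).
Proof. by rewrite -pos_lt /pos /rank -index_mem size_traject; lia. Qed.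

Lemma asc_sorted : sorted (fun a b => (pos a < pos b)%N) (asc x).
Proof.
have e : {in iota 1 n.-1, forall k, pos (letter k) = k}.
  by move=> k; rewrite mem_iota => hk; apply: pos_letter; lia.
rewrite ascE sorted_map; apply: (@sub_in_sorted _ (mem (iota 1 n.-1)) ltn).
- by move=> i j hi hj; rewrite /= !e.
- exact/allP.
- exact: iota_ltn_sorted.
Qed.

Lemma ohead_filter_sorted (T : eqType) (r : rel T) (s : seq T) (P : pred T) a :
  transitive r -> sorted r s -> a \in s -> P a ->
  (forall c, c \in s -> P c -> c != a -> r a c) -> irreflexive r ->
  ohead [seq c <- s | P c] = Some a.
Proof.
move=> tr so sa Pa h irr.
have fa : a \in [seq c <- s | P c] by rewrite mem_filter Pa.
have := sorted_filter tr P so; case E : [seq c <- s | P c] fa => [//|c s'].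
rewrite inE => /orP[/eqP->//|as'] /= pa; congr Some; apply/eqP/negPn/negP => ca.
have : c \in [seq c <- s | P c] by rewrite E mem_head.
rewrite mem_filter => /andP[Pc sc]; have ac := h c sc Pc ca.
have := order_path_min tr pa => /allP /(_ _ as') ca'.
by have := tr _ _ _ ac ca'; rewrite irr.
Qed.

Lemma ohead_asc (P : pred 'I_n) a : a != x -> P a ->
  (forall c, c != x -> P c -> (pos a <= pos c)%N) -> ohead [seq c <- asc x | P c] = Some a.
Proof.
move=> ax Pa h; apply: ohead_filter_sorted asc_sorted _ Pa _ _.
- by move=> ? ? ?; apply: ltn_trans.
- by rewrite mem_asc.
- move=> c; rewrite mem_asc => cx Pc ca; have := h c cx Pc.
  by rewrite leq_eqVlt => /orP[/eqP/pos_inj e|//]; rewrite e eqxx in ca.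
- by move=> c; rewrite ltnn.
Qed.

Lemma ohead_rev_asc (P : pred 'I_n) a : a != x -> P a ->
  (forall c, c != x -> P c -> (pos c <= pos a)%N) -> ohead [seq c <- rev (asc x) | P c] = Some a.
Proof.
move=> ax Pa h; apply: (@ohead_filter_sorted _ (fun a b => (pos b < pos a)%N)) => //.
- by move=> ? ? ? /[swap]; apply: ltn_trans.
- by rewrite rev_sorted asc_sorted.
- by rewrite mem_rev mem_asc.
- move=> c; rewrite mem_rev mem_asc => cx Pc ca; have := h c cx Pc.
  by rewrite leq_eqVlt => /orP[/eqP/pos_inj e|//]; rewrite e eqxx in ca.
- by move=> c; rewrite ltnn.
Qed.

Lemma ohead_ascP (P : pred 'I_n) :
  if ohead [seq c <- asc x | P c] is Some a
  then [/\ a != x, P a & forall c, c != x -> P c -> (pos a <= pos c)%N]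
  else forall c, c != x -> ~~ P c.
Proof.
case: (pickP (fun a => (a != x) && P a)) => [a0 Pa0|no]; last first.
  rewrite (_ : [seq c <- asc x | P c] = [::]) /=.
    by move=> c cx; have := no c; rewrite cx /= => ->.
  apply/eqP; rewrite -(negbK (_ == _)) -has_filter; apply/hasPn=> c.
  by rewrite mem_asc => cx; have := no c; rewrite cx /= => ->.
case: (@arg_minnP _ a0 (fun a => (a != x) && P a) pos Pa0) => a /andP[ax Pa] h.
rewrite (@ohead_asc P a) //; first by split=> // c cx Pc; apply: h; rewrite cx.
by move=> c cx Pc; apply: h; rewrite cx.
Qed.

Definition heightS (A C : {set 'I_n}) :=
  height (fun k => letter k \in A) (fun k => letter k \in C).

Lemma heightSS A C k : heightS A C k.+1 =
  heightS A C k + (letter k \in A : nat)%:Z - (letter k.+1 \in C : nat)%:Z.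
Proof. by []. Qed.

(** An opening bracket is unmatched when the path never returns to the height just before it, a
    closing one when the path reaches a new strict minimum there. *)
Definition unpaired_left (A C : {set 'I_n}) b :=
  b \in A /\ forall k, (pos b < k <= n)%N -> heightS A C (pos b) < heightS A C k.

Definition unpaired_right (A C : {set 'I_n}) a :=
  a \in C /\ forall k, (k < pos a)%N -> heightS A C (pos a) < heightS A C k.

Lemma heightS_lt_closing (A C : {set 'I_n}) c k : (forall i, letter i \notin A) ->
  c \in C -> (k < pos c)%N -> heightS A C (pos c) < heightS A C k.
Proof.
move=> f0 cC kc; have := posP c; case E : (pos c) kc => [//|m] kc [_ ec].
have le : heightS A C m <= heightS A C k by apply: height_decr.
by rewrite heightSS (negbTE (f0 m)) ec cC; lia.
Qed.

(** The letter [b] processed first is the last opening bracket and its partner the nearest closing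
    one beyond it, so no bracket lies between them. Removing the pair, or [b] alone when it has no
    partner, does not change which other brackets are unmatched. *)
Lemma pair_lettersP bs (A C : {set 'I_n}) : sorted (fun a b => (pos b < pos a)%N) bs ->
  A =i bs -> x \notin A -> x \notin C -> forall c : 'I_n,
  (c \in (pair_letters x bs C).1 <-> unpaired_left A C c) /\
  (c \in (pair_letters x bs C).2 <-> unpaired_right A C c).
Proof.
elim: bs A C => [|b bs IH] A C so eAb xA xC c.
  have f0 i : letter i \notin A by rewrite eAb.
  rewrite [pair_letters _ _ _]/= finset.in_set0; split.
    by split=> // -[]; rewrite eAb.
  by split=> [cC|[]//]; split=> // k kc; apply: heightS_lt_closing.
have {so} [so lt] : sorted (fun a b => (pos b < pos a)%N) bs /\
    {in bs, forall c, (pos c < pos b)%N}.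
  have tr : transitive (fun a b => (pos b < pos a)%N).
    by move=> ? ? ? /[swap]; apply: ltn_trans.
  by split; [apply: path_sorted so | apply/allP/(order_path_min tr)].
have bx : b != x by apply: contraNneq xA => <-; rewrite eAb mem_head.
have nb : b \notin bs by apply/negP=> /lt; rewrite ltnn.
have pbn : (pos b < n)%N by rewrite pos_lt.
pose A' := A :\ b; have eAb' : A' =i bs.
  move=> i; rewrite in_setD1 eAb inE; have [->|//] := eqVneq i b.
  by rewrite (negbTE nb).
have xA' : x \notin A' by rewrite in_setD1 (negbTE xA) andbF.
move: A' eAb' xA' => A' eAb' xA'.
have fb : letter (pos b) \in A by rewrite letter_pos eAb mem_head.
have f'b : ~~ (letter (pos b) \in A') by rewrite letter_pos eAb'.
have mem_le i : (i <= n)%N -> letter i \in A -> (i <= pos b)%N.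
  case: i => [//|i] iN; rewrite eAb inE => /orP[/eqP e|/lt].
    by rewrite -e pos_letter.
  by rewrite pos_letter // => /ltnW.
have eA i : (i <= n)%N -> i != pos b -> (letter i \in A') = (letter i \in A).
  move=> iN ib; rewrite eAb eAb' inE; case: eqP => // e; exfalso.
  case: i e ib iN => [e|i e] ib iN; first by rewrite -e eqxx in bx.
  by move: ib; rewrite -e pos_letter // eqxx.
have pc : (pos c <= n)%N by case/andP: (pos_range c).
have := ohead_ascP (fun a => (a \in C) && (rank x b < rank x a)%N).
rewrite [pair_letters _ _ _]/=; case: ohead => [a [ax /andP[aC ba] amin]|none].
  have pba : (pos b < pos a)%N by [].
  have pan : (pos a < n)%N by rewrite pos_lt.
  have pban : (pos b < pos a <= n)%N by rewrite pba ltnW.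
  have xC' : x \notin C :\ a by rewrite in_setD1 (negbTE xC) andbF.
  have [IHL IHR] := IH A' _ so eAb' xA' xC' c.
  have ga : letter (pos a) \in C by rewrite letter_pos.
  have g'a : ~~ (letter (pos a) \in C :\ a) by rewrite letter_pos in_setD1 eqxx.
  have eC i : (i <= n)%N -> i != pos a -> (letter i \in C :\ a) = (letter i \in C).
    move=> iN ia; rewrite in_setD1; case: eqP => // e; exfalso.
    case: i e ia iN => [e|i e] ia iN; first by rewrite -e eqxx in ax.
    by move: ia; rewrite -e pos_letter // eqxx.
  have H' k : (k <= n)%N ->
      heightS A' (C :\ a) k = heightS A C k - (pos b < k)%N%:Z + (pos a <= k)%N%:Z.
    move=> kn; rewrite /heightS.
    rewrite (@height_drop_closing _ (fun k => letter k \in C) _ (pos a)) //; last first.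
      by move=> i ik ia; apply: eC => //; apply: leq_trans kn.
    rewrite (@height_drop (fun k => letter k \in A) _ _ (pos b)) // => i ik ib.
    by apply: eA => //; apply: leq_trans kn; apply: ltnW.
  have gap i : (pos b < i < pos a)%N -> (letter i \notin A) && (letter i \notin C).
    case/andP=> bi ia; have iN := ltn_trans ia pan.
    have pi : pos (letter i) = i.
      by apply: pos_letter; rewrite (ltnW iN) andbT (leq_ltn_trans _ bi).
    apply/andP; split; first by apply/negP=> /(mem_le _ (ltnW iN)); rewrite leqNgt bi.
    apply/negP=> iC; have := amin (letter i).
    rewrite -pos_lt iC pi iN -ltnS -[(rank x (letter i)).+1]/(pos (letter i)) pi.
    by move=> /(_ isT bi); rewrite leqNgt ia.
  have Hgap k : (pos b < k < pos a)%N -> heightS A C k = heightS A C (pos b) + 1.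
    move=> hk; case/andP: (hk) => bk ka; rewrite /heightS (@height_gap _ _ (pos b) k) //.
      by have /andP[_ /negbTE->] := gap _ hk; rewrite subr0.
    by move=> i /andP[bi ik]; apply: gap; rewrite bi (ltn_trans ik ka).
  have Ha : heightS A C (pos a) = heightS A C (pos b).
    by rewrite /heightS (@height_gap _ _ (pos b) (pos a)) // ga addrK.
  rewrite IHL IHR; split.
    split=> -[cA h].
      rewrite eAb' in cA; split; first by rewrite eAb inE cA orbT.
      exact/(matched_left pban H' Hgap (lt _ cA)).
    move: cA; rewrite eAb inE => /orP[/eqP e|cA].
      by have := h (pos a); rewrite e Ha ltxx => /(_ pban).
    split; first by rewrite eAb'.
    exact/(matched_left pban H' Hgap (lt _ cA)).
  have npcq : c \in C -> ~~ (pos b < pos c < pos a)%N.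
    by move=> cC; apply/negP=> /gap; rewrite letter_pos cC andbF.
  split=> -[cC h].
    move: cC; rewrite in_setD1 => /andP[ca cC]; split=> //.
    have pca : pos c != pos a by rewrite (inj_eq pos_inj).
    exact/(matched_right pban H' Hgap Ha pc pca (npcq cC)).
  have ca : c != a.
    by apply/eqP=> e; have := h (pos b); rewrite e Ha ltxx => /(_ pba).
  have pca : pos c != pos a by rewrite (inj_eq pos_inj).
  split; first by rewrite in_setD1 ca.
  exact/(matched_right pban H' Hgap Ha pc pca (npcq cC)).
(* No closing bracket lies beyond [b], not even at position [n] since [x] is not in [C]; so the path
   stays one above its height at [b]. *)
have none' i : (pos b < i <= n)%N -> letter i \notin C.
  case/andP=> bi; rewrite leq_eqVlt => /orP[/eqP->|iN]; first by rewrite letter_n.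
  have pi : pos (letter i) = i.
    by apply: pos_letter; rewrite (ltnW iN) andbT (leq_ltn_trans _ bi).
  apply/negP=> iC; have := none (letter i).
  rewrite -pos_lt iC pi iN -ltnS -[(rank x (letter i)).+1]/(pos (letter i)) pi.
  by move=> /(_ isT); rewrite bi.
have [IHL IHR] := IH A' _ so eAb' xA' xC c.
case: (pair_letters x bs C) IHL IHR => L R /= IHL IHR.
have H' k : (k <= n)%N -> heightS A' C k = heightS A C k - (pos b < k)%N%:Z.
  move=> kn; rewrite /heightS.
  rewrite (@height_drop (fun k => letter k \in A) _ _ (pos b)) // => i ik ib.
  by apply: eA => //; apply: leq_trans kn; apply: ltnW.
have Hgap k : (pos b < k <= n)%N -> heightS A C k = heightS A C (pos b) + 1.
  move=> hk; case/andP: (hk) => bk kn; rewrite /heightS (@height_gap _ _ (pos b) k) //.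
    by rewrite (negbTE (none' k _)) ?subr0.
  move=> i /andP[bi ik]; rewrite none' ?bi ?andbT ?(ltnW (leq_trans ik kn)) //.
  by apply/negP=> /(mem_le _ (ltnW (leq_trans ik kn))); rewrite leqNgt bi.
rewrite in_setU1; split; split.
- case/orP=> [/eqP->|/IHL[cA h]].
    by split=> [|k hk]; [rewrite eAb mem_head | rewrite (Hgap k hk) ltrDl].
  rewrite eAb' in cA; split; first by rewrite eAb inE cA orbT.
  exact/(unmatched_left (ltnW pbn) H' Hgap (lt _ cA)).
- case; rewrite eAb in_cons => /orP[->//|cA] h; apply/orP; right; apply/IHL.
  split; first by rewrite eAb'.
  exact/(unmatched_left (ltnW pbn) H' Hgap (lt _ cA)).
- case/IHR=> cC h; have cb : (pos c <= pos b)%N.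
    by rewrite leqNgt; apply/negP=> cb; have := none' (pos c); rewrite letter_pos cC cb pc => /(_ isT).
  by split=> //; apply/(unmatched_right (ltnW pbn) H' cb).
- case=> cC h; apply/IHR; have cb : (pos c <= pos b)%N.
    by rewrite leqNgt; apply/negP=> cb; have := none' (pos c); rewrite letter_pos cC cb pc => /(_ isT).
  by split=> //; apply/(unmatched_right (ltnW pbn) H' cb).
Qed.

Lemma pairingP (A C : {set 'I_n}) c : x \notin A -> x \notin C ->
  (c \in (pairing x A C).1 <-> unpaired_left A C c) /\
  (c \in (pairing x A C).2 <-> unpaired_right A C c).
Proof.
move=> xA xC; apply: pair_lettersP => //.
  apply: sorted_filter; last by rewrite rev_sorted asc_sorted.
  by move=> ? ? ? /[swap]; apply: ltn_trans.
move=> i; rewrite mem_filter mem_rev mem_asc.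
by have [->|_] := eqVneq i x; rewrite ?andbT ?andbF // (negbTE xA).
Qed.

End Pairing.

(** * The crystal operators *)

Section Operators.
Local Open Scope ring_scope.
Variables (n : nat) (hn : (1 < n)%N) (w : affS n) (x : 'I_n).
Local Notation letter := (letter x).
Local Notation pos := (pos x).

Definition height_of (p : affS n * affS n) := heightS x (con p.1) (con p.2).

Lemma height_ofS p k : height_of p k.+1 =
  height_of p k + (letter k \in con p.1 : nat)%:Z - (letter k.+1 \in con p.2 : nat)%:Z.
Proof. by []. Qed.

Lemma letter_predn : letter n.-1 = ord_pred x.
Proof.
have e : letter n.-1.+1 = x by rewrite prednK ?(letter_n hn) // ltnW.
by rewrite -[in RHS]e letterS ordSK.
Qed.

Lemma pivot_notin p : factorizations w p -> pivot p x -> x \notin con p.1.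
Proof.
move=> fp; have ew : w = (p.1 * p.2)%g by case: fp.
case=> [|[_ [t []]]//]; rewrite -ew => /(in_parabolic_con hn x fp).
by rewrite finset.in_setU negb_or => /andP[].
Qed.

(** In the non-parabolic case the removed letters are the opening bracket at [n - 1] and the closing
    one at [n]. Their contributions cancel in the height at [n], and no earlier height involves
    them. Since the heights at [n - 1] and [n] agree, neither letter counts as unpaired for the full
    contents. *)
Lemma unpairedP p c : factorizations w p -> pivot p x ->
  (c \in (unpaired x p).1 <-> unpaired_left x (con p.1) (con p.2) c) /\
  (c \in (unpaired x p).2 <-> unpaired_right x (con p.1) (con p.2) c).
Proof.
move=> fp px; have ew : w = (p.1 * p.2)%g by case: fp.
rewrite /unpaired; case: asboolP => sp.
  case: px => [|[]//]; rewrite -ew => /(in_parabolic_con hn x fp).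
  by rewrite finset.in_setU negb_or => /andP[xU xV]; apply: pairingP.
case: px => [xp|[_ [t [t1 hU hV xU _]]]]; first by case: sp; exists x.
have xV : x \in con p.2 by apply: (hV 0).
have yU : ord_pred x \in con p.1 by apply: (hU 1); rewrite t1.
set A := _ :\ _; set C := _ :\ _.
have topE (B D : {set 'I_n}) : heightS x B D n =
    heightS x B D n.-1 + (ord_pred x \in B : nat)%:Z - (x \in D : nat)%:Z.
  have := heightSS x B D n.-1.
  by rewrite prednK ?(ltnW hn) // letter_predn letter_n.
have hE k : (k <= n)%N -> heightS x A C k = height_of p k.
  have lt_n j : (j < n)%N -> heightS x A C j = height_of p j.
    move=> jn; apply: eq_height => i hi.
      rewrite in_setD1 -letter_predn; case: eqP => // /(letter_inj hn) e; lia.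
    rewrite in_setD1 -{2}(letter_n hn x); case: eqP => // /(letter_inj hn) e; lia.
  rewrite leq_eqVlt => /orP[/eqP->|]; last exact: lt_n.
  rewrite /height_of !topE lt_n; last by lia.
  by rewrite !in_setD1 !eqxx yU xV /height_of /=; lia.
have hn1 : height_of p n = height_of p n.-1.
  by rewrite {1}/height_of topE yU xV /height_of; lia.
have [] := @pairingP n hn x A C c.
- by rewrite in_setD1 (negbTE xU) andbF.
- by rewrite in_setD1 eqxx.
have pcr := pos_range hn x c.
move=> -> ->; split; split=> -[cA h].
- split; first by case/setD1P: cA.
  by move=> k hk; have := h k hk; rewrite !hE //; lia.
- split; last by move=> k hk; rewrite !hE; [apply: h | lia..].
  rewrite in_setD1 cA andbT; apply/eqP=> e.
  have pc : pos c = n.-1 by rewrite e -letter_predn (pos_letter hn) //; lia.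
  by have := h n; rewrite pc -/(height_of p) hn1 ltxx => /(_ _)/notF; apply; lia.
- split; first by case/setD1P: cA.
  by move=> k hk; have := h k hk; rewrite !hE //; lia.
- split; last by move=> k hk; rewrite !hE; [apply: h | lia..].
  rewrite in_setD1 cA andbT; apply/eqP=> e.
  have pc : pos c = n by rewrite e pos_x.
  by have := h n.-1; rewrite pc -/(height_of p) hn1 ltxx => /(_ _)/notF; apply; lia.
Qed.

Definition last_argmin (h : nat -> int) (b : nat) := [/\ (b <= n)%N,
  forall k, (k <= n)%N -> h b <= h k & forall k, (b < k <= n)%N -> h b < h k].

Definition first_argmin (h : nat -> int) (a : nat) := [/\ (a <= n)%N,
  forall k, (k <= n)%N -> h a <= h k & forall k, (k < a)%N -> h a < h k].

Lemma zset_letter (U : {set 'I_n}) b k : (k <= b)%N ->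
  zset hn U (x%:Z + b%:Z - k%:Z) = (letter (b - k) \in U).
Proof.
move=> kb; rewrite /zset (letterE hn).
by rewrite (_ : x%:Z + b%:Z - k%:Z = x%:Z + (b - k)%N%:Z) //; lia.
Qed.

Lemma iter_pred_letter k b : (k <= b)%N -> iter k (@ord_pred n) (letter b) = letter (b - k).
Proof.
elim: k b => [|k IH] b kb; first by rewrite subn0.
rewrite iterS IH; last by lia.
by rewrite (_ : (b - k = (b - k.+1).+1)%N); [rewrite letterS ordSK | lia].
Qed.

Lemma iter_succ_letter k b : iter k (@ordS n) (letter b) = letter (b + k).
Proof. by rewrite addnC -iterD. Qed.

Lemma find_iotaP (P : pred nat) m : (exists2 i, (i < m)%N & P i) ->
  [/\ (find P (iota 0 m) < m)%N, P (find P (iota 0 m)) &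
      forall i, (i < find P (iota 0 m))%N -> ~~ P i].
Proof.
case=> i im Pi; have hs : has P (iota 0 m) by apply/hasP; exists i; rewrite ?mem_iota.
have lt : (find P (iota 0 m) < m)%N by rewrite has_find size_iota in hs.
split=> //; first by have := nth_find 0 hs; rewrite nth_iota.
move=> j jl; have := before_find 0 jl; rewrite nth_iota ?add0n ?(ltn_trans jl lt) //.
by move=> ->.
Qed.

(** The replacement of 1 3^t by 3^t 2 on the positions [b - t, ..., b]. As [t < b < n], this window
    avoids the positions [0] and [n], which carry the same letter [x]. *)
Definition e_move p b t p' := [/\ (t < b < n)%N,
  [/\ forall k, (k <= t)%N -> letter (b - k) \in con p.1, letter (b - t.+1) \notin con p.1,
      forall k, (k < t)%N -> letter (b - k) \in con p.2, letter (b - t) \notin con p.2 &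
      letter b.+1 \notin con p.2],
  factorizations w p', con p'.1 = con p.1 :\ letter b & con p'.2 = letter (b - t) |: con p.2].

Lemma e1_none p : factorizations w p -> pivot p x -> last_argmin (height_of p) n ->
  e1 x p = None.
Proof.
move=> fp px [_ hmin _]; rewrite /e1 /omin.
have := ohead_ascP hn x (fun a => a \in (unpaired x p).1).
case: ohead => // a [ax /(unpairedP a fp px).1 [aU h] _].
have pan : (pos a < n)%N by rewrite pos_lt.
have := h n; rewrite pan leqnn => /(_ isT).
by rewrite -/(height_of p) ltNge hmin // ltnW.
Qed.

Lemma e1_some p b : factorizations w p -> pivot p x -> last_argmin (height_of p) b ->
  (b < n)%N -> exists t p', e1 x p = Some p' /\ e_move p b t p'.
Proof.
move=> fp px [_ hmin hlast] bn; have xU := pivot_notin fp px.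
have hS := height_ofS p.
(* The path rises strictly from [b] to [b + 1], which needs an opening bracket at [b] and no closing
   one at [b + 1]. *)
have [Ub Vb] : letter b \in con p.1 /\ letter b.+1 \notin con p.2.
  have := hlast b.+1; rewrite hS ltnSn bn => /(_ isT).
  by case: (_ \in _); case: (_ \in _) => //; lia.
have b0 : (0 < b)%N by case: b Ub {Vb hlast hmin bn} => // xU'; rewrite xU' in xU.
have pb : pos (letter b) = b by rewrite (pos_letter hn) // b0 ltnW.
(* The height at a smaller unpaired letter would be below the minimum attained at [b]. *)
have om : omin x (unpaired x p).1 = Some (letter b).
  apply: (ohead_asc hn); first by rewrite -(pos_lt hn) pb.
    by apply/(unpairedP _ fp px).1; split=> // k; rewrite pb; apply: hlast.
  move=> c cx /(unpairedP c fp px).1 [_ h]; rewrite pb leqNgt; apply/negP=> cb.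
  by have := h b; rewrite cb ltnW // => /(_ isT); rewrite -/(height_of p) ltNge hmin // ltnW // (ltn_trans cb).
pose t := run_down (con p.1) (letter b).
have [_] : [/\ (t < n)%N, iter t.+1 (@ord_pred n) (letter b) \notin con p.1 &
    forall i, (i < t)%N -> ~~ (iter i.+1 (@ord_pred n) (letter b) \notin con p.1)].
  apply: find_iotaP; exists b.-1; first by lia.
  by rewrite prednK // iter_pred_letter // subnn.
move=> dt bt.
have tb : (t < b)%N.
  rewrite ltnNge; apply/negP=> tb; have := bt b.-1; rewrite prednK //.
  by rewrite iter_pred_letter // subnn xU => /(_ _)/negP; apply; lia.
rewrite iter_pred_letter // in dt.
have Ut k : (k <= t)%N -> letter (b - k) \in con p.1.
  case: k => [|k] kt; first by rewrite subn0.
  by have := bt _ kt; rewrite negbK iter_pred_letter //; lia.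
(* With an opening bracket at [b - k - 1] the path cannot fall from there to [b - k]; as the latter
   is a minimum, the heights agree. *)
have hconst k : (k <= t)%N -> height_of p (b - k) = height_of p b.
  elim: k => [|k IH] kt; first by rewrite subn0.
  apply/eqP; rewrite eq_le hmin ?andbT; last by lia.
  have e : (b - k = (b - k.+1).+1)%N by lia.
  rewrite -IH ?e ?hS -?e; last by lia.
  rewrite Ut // ; case: (_ \in con p.2) => /=; lia.
have Vt k : (k < t)%N -> letter (b - k) \in con p.2.
  move=> kt; have e : (b - k = (b - k.+1).+1)%N by lia.
  have := hconst k (ltnW kt); rewrite {1}e hS -e (hconst _ kt) Ut //.
  by case: (_ \in con p.2) => //=; lia.
(* Otherwise [b - t, ..., b] would be a run common to [U] and [V] forming the forbidden pattern. *)
have Vbt : letter (b - t) \notin con p.2.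
  apply/negP=> Vbt; have := @factorization_reduced n hn w p (x%:Z + b%:Z) t fp; apply.
  split.
  - move=> k kt; rewrite !zset_letter; [|lia..].
    rewrite Ut //=; have [->//|kt'] := eqVneq k t; apply: Vt; lia.
  - by rewrite zset_letter.
  - have := @zset_letter (con p.2) b.+1 0; rewrite !subn0 => /(_ isT).
    by rewrite (_ : x%:Z + b.+1%:Z - 0%:Z = x%:Z + b%:Z + 1) => [->//|]; lia.
case: (fp) => ew cu cv el.
have := @exchange_e n hn p.1 p.2 (x%:Z + b%:Z) t cu cv.
case.
- by move=> k kt; rewrite zset_letter ?Ut //; lia.
- by rewrite zset_letter.
- by move=> k kt; rewrite zset_letter ?Vt //; lia.
- by rewrite zset_letter //; lia.
- have := @zset_letter (con p.2) b.+1 0; rewrite !subn0 => /(_ isT).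
  by rewrite (_ : x%:Z + b.+1%:Z - 0%:Z = x%:Z + b%:Z + 1) => [->//|]; lia.
have -> : residue hn (x%:Z + b%:Z) = letter b by rewrite (letterE hn).
have -> : residue hn (x%:Z + b%:Z - t%:Z) = letter (b - t).
  by rewrite (letterE hn); congr residue; lia.
move=> u' [v' [cu' cv' eu' ev' e']]; exists t, (u', v'); split.
  rewrite /e1 om -/t iter_pred_letter; last by lia.
  by rewrite -eu' -ev' !(cyc_dec_of_con hn).
split=> //; first by rewrite tb.
split=> //=; first by rewrite -e'.
rewrite el (len_con hn cu) (len_con hn cv) (len_con hn cu') (len_con hn cv') eu' ev'.
by rewrite cardsU1 Vbt (cardsD1 (letter b) (con p.1)) Ub addnCA addnA.
Qed.

Definition f_move p a s p' := [/\ (0 < a <= a + s)%N /\ (a + s < n)%N,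
  [/\ forall k, (k <= s)%N -> letter (a + k) \in con p.2, letter (a + s.+1) \notin con p.2,
      forall k, (k < s)%N -> letter (a + k) \in con p.1, letter (a + s) \notin con p.1 &
      letter a.-1 \notin con p.1],
  factorizations w p', con p'.1 = letter (a + s) |: con p.1 & con p'.2 = con p.2 :\ letter a].

Lemma f1_none p : factorizations w p -> pivot p x -> first_argmin (height_of p) 0 ->
  f1 x p = None.
Proof.
move=> fp px [_ hmin _]; rewrite /f1 /omax.
case E : [seq a <- rev (asc x) | a \in (unpaired x p).2] => [|a s] //=; exfalso.
have : a \in [seq a <- rev (asc x) | a \in (unpaired x p).2] by rewrite E mem_head.
rewrite mem_filter mem_rev => /andP[/(unpairedP a fp px).2 [aV h] _].
have /andP[pa pan] := pos_range hn x a.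
by have := h 0 pa; rewrite -/(height_of p) ltNge hmin.
Qed.

Lemma f1_some p a : factorizations w p -> pivot p x -> first_argmin (height_of p) a ->
  (0 < a)%N -> exists s p', f1 x p = Some p' /\ f_move p a s p'.
Proof.
move=> fp px [an hmin hfirst] a0; have xU := pivot_notin fp px.
have hS := height_ofS p.
have ea : a = a.-1.+1 by lia.
have [Va Ua] : letter a \in con p.2 /\ letter a.-1 \notin con p.1.
  have := hfirst a.-1; rewrite ltn_predL a0 => /(_ isT).
  have := hS a.-1; rewrite -ea.
  by case: (_ \in _); case: (_ \in _) => //; lia.
have pa : pos (letter a) = a by rewrite (pos_letter hn) // a0.
(* If [x] lies in [V], the product does not avoid [x], so [x] is a pivot by admissibility. There
   [t < n], as a full turn would put [x] into [U]. *)
have pivV : x \in con p.2 -> exists t, [/\ (0 < t < n)%N,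
    forall k, (0 < k <= t)%N -> letter (n - k) \in con p.1 & letter (n - t) \notin con p.2].
  move=> xV; have ew : w = (p.1 * p.2)%g by case: fp.
  case: px => [|[_ [t [t1 hU hV _ nV]]]].
    rewrite -ew => /(in_parabolic_con hn x fp).
    by rewrite finset.in_setU xV orbT.
  have tn : (t < n)%N.
    rewrite ltnNge; apply/negP=> nt; have := hU n.
    have -> : iter n (@ord_pred n) x = x.
      by rewrite -{1}(letter_n hn x) iter_pred_letter // subnn.
    by rewrite (negbTE xU) => /(_ _)/notF; apply; lia.
  exists t; split; first by rewrite t1.
    move=> k hk; have := hU k hk.
    by rewrite -{1}(letter_n hn x) iter_pred_letter //; lia.
  by rewrite -(iter_pred_letter (ltnW tn)) letter_n.
pose s := run_up (con p.2) (letter a).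
have [_] : [/\ (s < n)%N, iter s.+1 (@ordS n) (letter a) \notin con p.2 &
    forall i, (i < s)%N -> ~~ (iter i.+1 (@ordS n) (letter a) \notin con p.2)].
  apply: find_iotaP; case: (fp) => _ _ cv _.
  have [y yz Vy] := zset_con_unbounded hn cv 0.
  have [z ez hz] := residue_surj_above hn (residue hn y) (x%:Z + a%:Z + 1).
  exists (absz (z - (x%:Z + a%:Z + 1))%R); first by lia.
  rewrite iter_succ_letter (letterE hn).
  by rewrite (_ : x%:Z + _ = z) ?ez //; lia.
rewrite iter_succ_letter => ds bs.
have Vs k : (k <= s)%N -> letter (a + k) \in con p.2.
  case: k => [|k] ks; first by rewrite addn0.
  by have := bs _ ks; rewrite negbK iter_succ_letter.
(* Each closing bracket following the minimum at [a] must be compensated by an opening one just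
   before it. *)
have steps k : (k <= s)%N -> (a + k <= n)%N ->
    height_of p (a + k) = height_of p a /\ forall j, (j < k)%N -> letter (a + j) \in con p.1.
  elim: k => [|k IH] ks kn; first by rewrite addn0.
  have [||e Uj] := IH; [lia|lia|].
  have := hmin _ kn; rewrite addnS hS -addnS Vs // e.
  case Uk : (letter (a + k) \in con p.1) => /= le; last by exfalso; lia.
  by split=> [|j jk]; [lia | have [->//|jk'] := eqVneq j k; apply: Uj; lia].
(* A run of [V] reaching [n] would put [x] into [V]. The position [n - t] outside [V] must then lie
   below [a], so that [a - 1] belongs to the run of [U] below [n], contradicting [Ua]. *)
have asn : (a + s < n)%N.
  rewrite ltnNge; apply/negP=> nas.
  have [||_ Uj] := steps (n - a)%N; [lia|lia|].
  have xV : x \in con p.2.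
    by have := Vs (n - a)%N; rewrite subnKC // letter_n //; apply; lia.
  have [t [tn hU nV]] := pivV xV.
  case: (leqP a (n - t)) => ant.
    have := Vs (n - t - a)%N; rewrite (_ : (a + (n - t - a) = n - t)%N); last by lia.
    by rewrite (negbTE nV) => /(_ _)/notF; apply; lia.
  have := hU (n - a.-1)%N; rewrite (_ : (n - (n - a.-1) = a.-1)%N); last by lia.
  by rewrite (negbTE Ua) => /(_ _)/notF; apply; lia.
have [//|hs Us] := steps s (leqnn _); first exact: ltnW.
(* Otherwise [a, ..., a + s] would carry the forbidden pattern. *)
have Uas : letter (a + s) \notin con p.1.
  apply/negP=> Uas.
  have := @factorization_reduced n hn w p (x%:Z + (a + s)%N%:Z) s fp; apply.
  split.
  - move=> k ks; rewrite !zset_letter; [|lia..].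
    rewrite (_ : (a + s - k = a + (s - k))%N); last by lia.
    rewrite Vs ?andbT; last by lia.
    by have [->|k0] := eqVneq k 0; [rewrite subn0 | apply: Us; lia].
  - rewrite zset_letter; last by lia.
    by rewrite (_ : (a + s - s.+1 = a.-1)%N) //; lia.
  - have := @zset_letter (con p.2) (a + s.+1)%N 0; rewrite !subn0 => /(_ isT).
    by rewrite (_ : x%:Z + (a + s.+1)%N%:Z - 0%:Z = x%:Z + (a + s)%N%:Z + 1) => [->//|]; lia.
case: (fp) => ew cu cv el.
have om : omax x (unpaired x p).2 = Some (letter a).
  apply: (ohead_rev_asc hn); first by rewrite -(pos_lt hn) pa; lia.
    by apply/(unpairedP _ fp px).2; split=> // k; rewrite pa; apply: hfirst.
  move=> c cx /(unpairedP c fp px).2 [_ h]; rewrite pa leqNgt; apply/negP=> cb.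
  by have := h a cb; rewrite -/(height_of p) ltNge hmin //; case/andP: (pos_range hn x c).
have := @exchange_f n hn p.1 p.2 (x%:Z + (a + s)%N%:Z) s cu cv.
case.
- move=> k ks; rewrite zset_letter; last by lia.
  by rewrite (_ : (a + s - k = a + (s - k))%N) ?Vs //; lia.
- have := @zset_letter (con p.2) (a + s.+1)%N 0; rewrite !subn0 => /(_ isT).
  by rewrite (_ : x%:Z + (a + s.+1)%N%:Z - 0%:Z = x%:Z + (a + s)%N%:Z + 1) => [->//|]; lia.
- move=> k ks; rewrite zset_letter; last by lia.
  by rewrite (_ : (a + s - k = a + (s - k))%N) ?Us //; lia.
- by have := @zset_letter (con p.1) (a + s)%N 0; rewrite !subn0 subr0 => ->.
- rewrite zset_letter; last by lia.
  by rewrite (_ : (a + s - s.+1 = a.-1)%N) //; lia.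
have -> : residue hn (x%:Z + (a + s)%N%:Z) = letter (a + s) by rewrite (letterE hn).
have -> : residue hn (x%:Z + (a + s)%N%:Z - s%:Z) = letter a.
  by rewrite (letterE hn); congr residue; lia.
move=> u' [v' [cu' cv' eu' ev' e']]; exists s, (u', v'); split.
  by rewrite /f1 om -/s iter_succ_letter -eu' -ev' !(cyc_dec_of_con hn).
split=> //; first by split=> //; lia.
split=> //=; first by rewrite -e'.
rewrite el (len_con hn cu) (len_con hn cv) (len_con hn cu') (len_con hn cv') eu' ev'.
by rewrite cardsU1 Uas (cardsD1 (letter a) (con p.2)) Va [RHS]addnCA addnA.
Qed.

End Operators.

(** * Inverse operators, strings and weights *)

Section Strings.
Local Open Scope ring_scope.
Variables (n : nat) (hn : (1 < n)%N) (w : affS n) (x : 'I_n).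
Hypothesis piv : forall p, factorizations w p -> pivot p x.
Local Notation letter := (letter x).
Local Notation height_of := (height_of x).
Local Notation e_move := (e_move w x).
Local Notation f_move := (f_move w x).

Lemma factorization_inj p p' : factorizations w p -> factorizations w p' ->
  con p.1 = con p'.1 -> con p.2 = con p'.2 -> p = p'.
Proof.
case: p p' => u v [u' v'] [/= _ cu cv _] [/= _ cu' cv' _] e1 e2.
by rewrite (cyc_dec_inj hn cu cu' e1) (cyc_dec_inj hn cv cv' e2).
Qed.

Lemma letter_eq i j : (0 < j < n)%N -> (i <= n)%N -> (letter i == letter j) = (i == j).
Proof.
move=> hj hi; apply/eqP/eqP=> [/(letter_inj hn)|->//]; apply; lia.
Qed.

Lemma e_move_f_move p b t p' : factorizations w p -> e_move p b t p' -> f_move p' (b - t) t p.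
Proof.
move=> fp [tb [h1 h2 h3 h4 h5] fp' e1 e2].
have ebt : (b - t + t = b)%N by lia.
have Ub := h1 0 isT; rewrite subn0 in Ub.
split=> //; rewrite ?ebt.
- by lia.
- split.
  + move=> k kt; rewrite e2 in_setU1; have [->|k0] := eqVneq k 0; first by rewrite addn0 eqxx.
    by rewrite (_ : (b - t + k = b - (t - k))%N) ?h3 ?orbT //; lia.
  + rewrite addnS ebt e2 in_setU1 negb_or h5 andbT.
    by rewrite letter_eq; lia.
  + move=> k kt; rewrite e1 in_setD1 letter_eq; [|lia..].
    by rewrite (_ : (b - t + k = b - (t - k))%N) ?h1; lia.
  + by rewrite e1 in_setD1 eqxx.
  + by rewrite e1 in_setD1 -subnS (negbTE h2) andbF.
- by rewrite e1 finset.setD1K.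
- by rewrite e2 finset.setU1K.
Qed.

Lemma f_move_e_move p a s p' : factorizations w p -> f_move p a s p' -> e_move p' (a + s) s p.
Proof.
move=> fp [[ha as_n] [h1 h2 h3 h4 h5] fp' e1 e2].
have Va := h1 0 isT; rewrite addn0 in Va.
split=> //; rewrite ?addnK.
- by lia.
- split.
  + move=> k ks; rewrite e1 in_setU1; have [->|k0] := eqVneq k 0; first by rewrite subn0 eqxx.
    by rewrite (_ : (a + s - k = a + (s - k))%N) ?h3 ?orbT //; lia.
  + rewrite (_ : (a + s - s.+1 = a.-1)%N); last by lia.
    rewrite e1 in_setU1 negb_or h5 andbT.
    by rewrite letter_eq; lia.
  + move=> k kt; rewrite e2 in_setD1 letter_eq; [|lia..].
    by rewrite (_ : (a + s - k = a + (s - k))%N) ?h1; lia.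
  + by rewrite e2 in_setD1 eqxx.
  + by rewrite e2 in_setD1 -addnS (negbTE h2) andbF.
- by rewrite e1 finset.setU1K.
- by rewrite e2 finset.setD1K.
Qed.

Lemma e_move_unique p b t t' p' p'' : e_move p b t p' -> e_move p b t' p'' -> p' = p''.
Proof.
move=> [tb [h1 h2 _ _ _] fp' e1 e2] [tb' [h1' h2' _ _ _] fp'' e1' e2'].
have e : t = t'.
  by case: (ltngtP t t') => // lt; [rewrite h1' in h2 | rewrite h1 in h2'].
by apply: factorization_inj => //; rewrite ?e1' ?e2' -?e.
Qed.

Lemma f_move_unique p a s s' p' p'' : f_move p a s p' -> f_move p a s' p'' -> p' = p''.
Proof.
move=> [_ [h1 h2 _ _ _] fp' e1 e2] [_ [h1' h2' _ _ _] fp'' e1' e2'].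
have e : s = s'.
  by case: (ltngtP s s') => // lt; [rewrite h1' in h2 | rewrite h1 in h2'].
by apply: factorization_inj => //; rewrite ?e1' ?e2' -?e.
Qed.

Lemma e_move_height p b t p' k : e_move p b t p' -> (k <= n)%N ->
  height_of p' k = height_of p k - (b < k)%N%:Z - (b - t <= k)%N%:Z.
Proof.
move=> [tb [h1 h2 h3 h4 h5] fp' e1 e2] kn.
have Ub := h1 0 isT; rewrite subn0 in Ub.
transitivity (heightS x (con p'.1) (con p.2) k - (b - t <= k)%N%:Z).
  apply/eqP; rewrite eq_sym subr_eq; apply/eqP.
  apply: height_drop_closing; rewrite ?e2 ?finset.setU11 //; first by lia.
  move=> i ik ib; rewrite in_setU1 letter_eq ?(negbTE ib) //; lia.
congr (_ - _); apply: height_drop; rewrite ?e1 ?finset.setD11 // => i ik ib.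
by rewrite in_setD1 letter_eq ?ib //; lia.
Qed.

Lemma e_move_const p b t p' k : e_move p b t p' -> (k <= t)%N ->
  height_of p (b - k) = height_of p b.
Proof.
move=> [tb [h1 h2 h3 h4 h5] fp' e1 e2]; elim: k => [|k IH] kt; first by rewrite subn0.
have e : (b - k = (b - k.+1).+1)%N by lia.
rewrite -IH; last by lia.
by rewrite [in RHS]e height_ofS -e h1 // h3 //; lia.
Qed.

(** Before [b - t] the heights are unchanged, from there to [b] they fall by one, and beyond [b] by
    two. Beyond [b] they were strictly above the minimum, so none falls below the new minimum
    reached at [b - t]. *)
Lemma e_move_first_argmin p b t p' : e_move p b t p' -> last_argmin n (height_of p) b ->
  first_argmin n (height_of p') (b - t).
Proof.
move=> m [bn hmin hlast]; have hk := e_move_const m; have hE k := @e_move_height p b t p' k m.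
have tb : (t < b < n)%N by case: m.
have e : height_of p' (b - t) = height_of p b - 1.
  rewrite hE; last by lia.
  by rewrite hk // leqnn; lia.
have key (k : nat) : (k <= n)%N -> [/\ height_of p b <= height_of p k,
    ((b < k)%N -> height_of p b < height_of p k) &
    height_of p' k = height_of p k - (b < k)%N%:Z - (b - t <= k)%N%:Z].
  by move=> kn; split; [apply: hmin | move=> bk; apply: hlast; rewrite bk | apply: hE].
split=> [|k kn|k kb]; first by lia.
  by rewrite e; have [k1 k2 ->] := key k kn; lia.
have kn : (k <= n)%N by lia.
by rewrite e; have [k1 k2 ->] := key k kn; lia.
Qed.

Lemma f_move_last_argmin p a s p' : factorizations w p -> f_move p a s p' ->
  first_argmin n (height_of p) a -> last_argmin n (height_of p') (a + s).
Proof.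
move=> fp fm [an hmin hfirst].
have m := f_move_e_move fp fm; have hE k := @e_move_height p' (a + s) s p k m.
have asn : (0 < a /\ a + s < n)%N by case: fm => -[h1 h2] _ _ _ _; lia.
rewrite addnK in hE.
have e : height_of p' (a + s) = height_of p a + 1.
  have := e_move_const m (leqnn s); rewrite addnK => <-.
  by rewrite (hE a an) ltnNge leq_addr leqnn subr0 subrK.
have key (k : nat) : (k <= n)%N -> [/\ height_of p a <= height_of p k,
    ((k < a)%N -> height_of p a < height_of p k) &
    height_of p k = height_of p' k - (a + s < k)%N%:Z - (a <= k)%N%:Z].
  by move=> kn; split; [apply: hmin | apply: hfirst | apply: hE].
split=> [|k kn|k kb]; first by lia.
  by rewrite e; have [k1 k2 k3] := key k kn; lia.
have kn : (k <= n)%N by lia.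
by rewrite e; have [k1 k2 k3] := key k kn; lia.
Qed.

Lemma e1_cases p : factorizations w p -> exists b, last_argmin n (height_of p) b /\
  if (b < n)%N then exists t p', e1 x p = Some p' /\ e_move p b t p'
  else b = n /\ e1 x p = None.
Proof.
move=> fp; have [b bn [h1 h2]] := ex_last_argmin (height_of p) n.
have la : last_argmin n (height_of p) b by split.
exists b; split=> //; case: ltnP => lt; first exact: (e1_some hn fp (piv fp) la).
have eb : b = n by lia.
by split=> //; apply: (e1_none hn fp (piv fp)); rewrite eb in la.
Qed.

Lemma f1_cases p : factorizations w p -> exists a, first_argmin n (height_of p) a /\
  if (0 < a)%N then exists s p', f1 x p = Some p' /\ f_move p a s p'
  else a = 0%N /\ f1 x p = None.
Proof.
move=> fp; have [a an [h1 h2]] := ex_first_argmin (height_of p) n.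
have la : first_argmin n (height_of p) a by split.
exists a; split=> //; case: ltnP => lt; first exact: (f1_some hn fp (piv fp) la).
have ea : a = 0%N by lia.
by split=> //; apply: (f1_none hn fp (piv fp)); rewrite -ea.
Qed.

Lemma last_argmin_unique h b b' : last_argmin n h b -> last_argmin n h b' -> b = b'.
Proof.
move=> [bn h1 h2] [bn' h1' h2']; case: (ltngtP b b') => // lt.
  by have := h2 b'; rewrite lt bn' => /(_ isT); rewrite ltNge h1'.
by have := h2' b; rewrite lt bn => /(_ isT); rewrite ltNge h1.
Qed.

Lemma first_argmin_unique h a a' : first_argmin n h a -> first_argmin n h a' -> a = a'.
Proof.
move=> [an h1 h2] [an' h1' h2']; case: (ltngtP a a') => // lt.
  by have := h2' a lt; rewrite ltNge h1.
by have := h2 a' lt; rewrite ltNge h1'.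
Qed.

Lemma e1_inv p p' : factorizations w p -> e1 x p = Some p' ->
  factorizations w p' /\ f1 x p' = Some p.
Proof.
move=> fp ep; have [b [la]] := e1_cases fp; case: ltnP => lt; last by rewrite ep => -[].
case=> t [q []]; rewrite ep => -[<-] m; have fp' : factorizations w p' by case: m.
split=> //; have [a [fa]] := f1_cases fp'.
have ea := first_argmin_unique fa (e_move_first_argmin m la).
have -> : (0 < a)%N by rewrite ea; case: m => tb _ _ _ _; lia.
case=> s [q' [-> fm]]; rewrite ea in fm.
by rewrite (f_move_unique fm (e_move_f_move fp m)).
Qed.

Lemma f1_inv p p' : factorizations w p -> f1 x p = Some p' ->
  factorizations w p' /\ e1 x p' = Some p.
Proof.
move=> fp ep; have [a [fa]] := f1_cases fp; case: ltnP => lt; last by rewrite ep => -[].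
case=> s [q []]; rewrite ep => -[<-] m; have fp' : factorizations w p' by case: m.
split=> //; have [b [la]] := e1_cases fp'.
have eb := last_argmin_unique la (f_move_last_argmin fp m fa).
have -> : (b < n)%N by rewrite eb; case: m => -[? ?] _ _ _ _.
case=> t [q' [-> em]]; rewrite eb in em.
by rewrite (e_move_unique em (f_move_e_move fp m)).
Qed.

Lemma e1_weight p p' : factorizations w p -> e1 x p = Some p' ->
  weight p' = weight p + (1, -1).
Proof.
move=> fp ep; have [b [la]] := e1_cases fp; case: ltnP => lt; last by rewrite ep => -[].
case=> t [q []]; rewrite ep => -[<-] [tb [h1 h2 h3 h4 h5] fp' e1 e2].
case: fp fp' => _ cu cv _ [_ cu' cv' _].
have Ub := h1 0 isT; rewrite subn0 in Ub.
rewrite /weight !(len_con hn) // e1 e2 cardsU1 h4 (cardsD1 (letter b) (con p.1)) Ub.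
congr pair; rewrite /= ?PoszD; first by rewrite addrC.
by rewrite addrC addrA addNr add0r.
Qed.

Lemma f1_weight p p' : factorizations w p -> f1 x p = Some p' ->
  weight p' = weight p - (1, -1).
Proof.
move=> fp ep; have [fp' ep'] := f1_inv fp ep.
by rewrite (e1_weight fp' ep') addrK.
Qed.

(** [e1] lowers the final height by two and the minimum by one, so their difference decreases by
    one; it is zero exactly when the last minimum is at [n]. *)
Lemma e1_string p d b : factorizations w p -> last_argmin n (height_of p) b ->
  height_of p n - height_of p b = d%:Z -> string_length (e1 x) p d.
Proof.
elim: d p b => [|d IH] p b fp la ed; have [b' [la']] := e1_cases fp;
  rewrite (last_argmin_unique la' la).
  case: ltnP => lt; last by case=> _ e; split.
  by case: la => _ _ h; have := h n; lia.
case: ltnP => lt; last by case=> eb; move: ed; rewrite eb; lia.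
case=> t [p' [ep m]]; have [fp' _] := e1_inv fp ep.
have fa := e_move_first_argmin m la.
have [c [la'' _]] := e1_cases fp'.
have tb : (t < b < n)%N by case: m.
have ec : height_of p' c = height_of p' (b - t).
  case: la'' fa => cn c1 _ [btn f1_ _]; apply/eqP; rewrite eq_le c1 //.
  exact: f1_.
have ed' : height_of p' n - height_of p' c = d%:Z.
  rewrite ec !(e_move_height m) //; last by lia.
  by rewrite (e_move_const m) // leqnn lt; lia.
have [h1 h2] := IH p' c fp' la'' ed'.
by split; rewrite iterSr /= ep.
Qed.

(** The path starts at height 0, and [f1] raises its minimum by one until the minimum is attained at
    the start. *)
Lemma f1_string p d a : factorizations w p -> first_argmin n (height_of p) a ->
  - height_of p a = d%:Z -> string_length (f1 x) p d.
Proof.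
elim: d p a => [|d IH] p a fp fa ed; have [a' [fa']] := f1_cases fp;
  rewrite (first_argmin_unique fa' fa).
  case: ltnP => lt; last by case=> _ e; split.
  by case: fa => _ _ h; have : height_of p a < 0 := h 0%N lt; lia.
case: ltnP => lt; last by case=> ea; move: ed; rewrite ea.
case=> s [p' [ep fm]]; have [fp' _] := f1_inv fp ep.
have m := f_move_e_move fp fm.
have la := f_move_last_argmin fp fm fa.
have [c [fa'' _]] := f1_cases fp'.
have asn : (a + s < n)%N by case: fm => -[? ?] _ _ _ _.
have ec : height_of p' c = height_of p' (a + s).
  case: fa'' la => cn c1 _ [btn l1 _]; apply/eqP; rewrite eq_le c1 //.
  exact: l1.
have ed' : - height_of p' c = d%:Z.
  have := e_move_const m (leqnn s); rewrite addnK => e.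
  have an : (a <= n)%N by case: fa.
  by move: ed; rewrite (e_move_height m an) addnK ltnNge leq_addr leqnn subr0 e ec; lia.
have [h1 h2] := IH p' c fp' fa'' ed'.
by split; rewrite iterSr /= ep.
Qed.

Lemma card_letters (U : {set 'I_n}) (g : nat -> nat) :
  (forall i j, (i < n)%N -> (j < n)%N -> letter (g i) = letter (g j) -> i = j) ->
  \sum_(i < n) (letter (g i) \in U : nat) = #|U|.
Proof.
move=> inj; rewrite -sum1_card [RHS]big_mkcond /=.
rewrite [RHS](reindex_inj (h := fun i : 'I_n => letter (g i))).
  by apply: eq_bigr => i _; case: (_ \in _).
by move=> i j e; apply: val_inj; apply: (inj _ _ (ltn_ord i) (ltn_ord j) e).
Qed.

Lemma height_sum (f g : nat -> bool) k :
  height f g k = (\sum_(i < k) (f i : nat))%N%:Z - (\sum_(i < k) (g i.+1 : nat))%N%:Z.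
Proof.
elim: k => [|k IH]; first by rewrite !big_ord0.
by rewrite !big_ord_recr /= IH !PoszD opprD addrACA addrA.
Qed.

(** Openings are counted at the positions 0, ..., n-1 and closings at 1, ..., n; either range meets
    each letter exactly once. *)
Lemma height_n p : factorizations w p -> height_of p n = (weight p).2 - (weight p).1.
Proof.
case=> _ cu cv _; rewrite /weight /= !(len_con hn) //.
rewrite -[LHS]/(heightS x (con p.1) (con p.2) n) /heightS height_sum; congr (_%:Z - _%:Z).
  by apply: (@card_letters _ id) => i j hi hj /(letter_inj hn) e; lia.
apply: (@card_letters _ S) => i j hi hj /(letter_inj hn) e; lia.
Qed.

Lemma factorizations_crystal_axioms p0 : factorizations w p0 ->
  crystal_axioms (factorizations w) (e1 x) (f1 x) (@weight n).
Proof.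
move=> fp0; split.
- by exists p0.
- by move=> p p' fp /(e1_inv fp)[].
- by move=> p p' fp /(f1_inv fp)[].
- move=> p p' fp fp'; split=> [/(f1_inv fp)[]//|/(e1_inv fp')[]//].
- by move=> p p'; apply: e1_weight.
- by move=> p p'; apply: f1_weight.
move=> p fp; have [b [la _]] := e1_cases fp; have [a [fa _]] := f1_cases fp.
have eab : height_of p a = height_of p b.
  case: la fa => bn b1 _ [an a1 _]; apply/eqP; rewrite eq_le a1 //.
  exact: b1.
have d0 : 0 <= height_of p n - height_of p b.
  by rewrite subr_ge0; case: la => _ h _; apply: h.
have d1 : 0 <= - height_of p a.
  by rewrite oppr_ge0; case: fa => _ h _; apply: (h 0%N).
exists (absz (height_of p n - height_of p b)), (absz (- height_of p a)); split.
- by apply: e1_string la _ => //; rewrite gez0_abs.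
- by apply: f1_string fa _ => //; rewrite gez0_abs.
- rewrite !gez0_abs // eab (height_n fp); lia.
Qed.

End Strings.

(** A factorization is determined by its two contents, of which there are finitely many. *)
Lemma factorizations_finite (n : nat) (hn : (1 < n)%N) (w : affS n) :
  exists2 s : seq (affS n * affS n), uniq s & forall p, factorizations w p <-> p \in s.
Proof.
pose g (AC : {set 'I_n} * {set 'I_n}) := (cyc_dec_of AC.1, cyc_dec_of AC.2).
exists (undup [seq p <- [seq g AC | AC : {set 'I_n} * {set 'I_n}] | `[< factorizations w p >]]).
  exact: undup_uniq.
move=> p; rewrite mem_undup mem_filter; split=> [fp|/andP[/asboolP]//].
apply/andP; split; first exact/asboolP.
apply/mapP; exists (con p.1, con p.2); first by rewrite mem_enum.
by case: p fp => u v [/= _ cu cv _]; rewrite /g !(cyc_dec_of_con hn).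
Qed.

Theorem theorem3p14 (n : nat) (hn : (2 <= n)%N) (w : affS n)
    (p0 : affS n * affS n) (hp0 : factorizations w p0) :
  (exists x : 'I_n, pivot p0 x) /\
  forall x : 'I_n, pivot p0 x ->
    (forall p, factorizations w p -> pivot p x) /\
    Uq_sl2_crystal (factorizations w) (e1 x) (f1 x) (@weight n).
Proof.
have prodE p : factorizations w p -> (p.1 * p.2)%g = w by case.
split.
  have [[x hx]|np] := pselect (some_parabolic w).
    by exists x; left; rewrite prodE.
  have [x hx] := ex_admissible hn hp0 np.
  by exists x; right; rewrite prodE.
move=> x px.
(* The parabolic alternative mentions only the product; the other one passes between factorizations
   by [admissible_invariant]. *)
have piv p : factorizations w p -> pivot p x.
  move=> fp; case: px; rewrite /pivot !prodE //; first by left.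
  by case=> np ax; right; split=> //; apply: (admissible_invariant hn hp0).
split=> //; have ax := factorizations_crystal_axioms hn piv hp0.
split=> //; have [s us hs] := factorizations_finite hn w.
exact: finite_crystal_integrable us hs ax.
Qed.
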